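(* Let $(A,\mathfrak m)$ be a regular local ring. Let $\phi\colon \mathcal K^2(\operatorname{proj} A)\to \mathcal D^2_{fg}(A)$ be the natural exact functor from the homotopy category of $2$-periodic complexes of finitely generated free $A$-modules to the derived category of $2$-periodic complexes of $A$-modules with finitely generated cohomology (inclusion into $\mathcal K^2_{fg}(\operatorname{Mod} A)$ followed by the Verdier quotient functor). Then $\phi$ is an equivalence of triangulated categories.
   Context: Complexes are indexed cohomologically. Let $\mathcal A$ be a full additive subcategory of $\operatorname{Mod}(A)$ (e.g. $\operatorname{Mod}(A)$, $\operatorname{mod}(A)$ = finitely generated modules, $\operatorname{proj}(A)$ = finitely generated projective, equivalently free, modules over the local ring $A$). A $2$-periodic $\mathcal A$-complex is a complex $X$ with terms in $\mathcal A$ such that $X^{n+2}=X^n$ and $\partial_{n+2}=\partial_n$ for all $n\in\mathbb Z$. A $2$-periodic map is a chain map $f$ with $f_{n+2}=f_n$ for all $n$. $\mathcal C^2(\mathcal A)$ is the category of $2$-periodic $\mathcal A$-complexes and $2$-periodic maps. Two $2$-periodic maps $f,g\colon X\to Y$ are $2$-homotopic if there are maps $s_n\colon X^n\to Y^{n-1}$ with $s_{n+2}=s_n$ for all $n$ and $f-g=\partial_Y s+s\partial_X$. $\mathcal K^2(\mathcal A)$ is the category with the same objects and $2$-homotopy classes of $2$-periodic maps. Shift: $X[1]^n=X^{n+1}$, $\partial_{X[1],n}=-\partial_{X,n+1}$. Cone of $f\colon X\to Y$: $\operatorname{cone}(f)^n=X^{n+1}\oplus Y^n$ with $\partial_n(x,y)=(-\partial_{X,n+1}(x),\partial_{Y,n}(y)-f_{n+1}(x))$.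 $\mathcal K^2(\mathcal A)$ is triangulated, the exact triangles being those isomorphic to $X\xrightarrow{f}Y\xrightarrow{u}\operatorname{cone}(f)\xrightarrow{v}X[1]$, where $u_n(y)=(0,y)$, $v_n(x,y)=-x$. $\mathcal K^2_{fg}(\operatorname{Mod} A)$ is the thick subcategory of $\mathcal K^2(\operatorname{Mod} A)$ of complexes $X$ with $H^i(X)$ finitely generated over $A$ for all $i$. $\mathcal D^2_{fg}(A)=\mathcal D^2_{fg}(\operatorname{Mod} A)$ is the Verdier quotient of $\mathcal K^2_{fg}(\operatorname{Mod} A)$ by its thick subcategory of acyclic complexes ($H^*(X)=0$). *)

(* Defs.v *)
From HB Require Import structures.
From mathcomp Require Import all_boot all_order all_algebra.
From mathcomp Require Import boolp.

Set Implicit Arguments.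
Unset Strict Implicit.
Unset Printing Implicit Defensive.

Import GRing.Theory.
Local Open Scope ring_scope.
Local Obligation Tactic := idtac.

(* [idealr_closed] of MathComp describes the PROPER ideals. *)
Section RegularLocalRing.
Variable A : comNzRingType.
Implicit Types I J m : {pred A}.

Definition prime_ideal I := idealr_closed I /\ prime_idealr_closed I.

Definition maximal_ideal I :=
  idealr_closed I /\
  forall J, idealr_closed J -> {subset I <= J} -> J =i I.

Definition generates n (x : 'I_n -> A) I :=
  forall a, a \in I <-> exists c : 'I_n -> A, a = \sum_i c i * x i.

Definition noetherian_ring :=
  forall I, idealr_closed I -> exists n (x : 'I_n -> A), generates x I.

Definition local_ring m :=
  maximal_ideal m /\ forall I, maximal_ideal I -> I =i m.

Definition prime_chain n (p : nat -> {pred A}) :=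
  (forall i, (i <= n)%N -> prime_ideal (p i)) /\
  (forall i, (i < n)%N ->
     {subset p i <= p i.+1} /\ ~ {subset p i.+1 <= p i}).

Definition krull_dim d :=
  (exists p, prime_chain d p) /\ forall n p, prime_chain n p -> (n <= d)%N.

Definition regular_local_ring m :=
  [/\ noetherian_ring, local_ring m &
      exists d, krull_dim d /\ exists x : 'I_d -> A, generates x m].

End RegularLocalRing.

Section Modules.
Variable A : comNzRingType.

Definition fg_module (M : lmodType A) :=
  exists n (x : 'I_n -> M), forall y, exists c : 'I_n -> A,
    y = \sum_i c i *: x i.

Definition projective_module (P : lmodType A) :=
  forall (M N : lmodType A) (p : {linear M -> N}) (f : {linear P -> N}),
    (forall y, exists x, p x = y) ->
    exists g : {linear P -> M}, forall x, p (g x) = f x.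

Definition proj_module (P : lmodType A) := fg_module P /\ projective_module P.

(* The cohomology ker b / im a of L -a-> M -b-> N is finitely generated: the
   cocycles z i represent generators of the quotient. *)
Definition fg_cohomology (L M N : lmodType A)
    (a : {linear L -> M}) (b : {linear M -> N}) :=
  exists n (z : 'I_n -> M), (forall i, b (z i) = 0) /\
    forall y, b y = 0 -> exists (c : 'I_n -> A) (w : L),
      y = \sum_i c i *: z i + a w.

Definition exact_at (L M N : lmodType A)
    (a : {linear L -> M}) (b : {linear M -> N}) :=
  forall y, b y = 0 -> exists w, y = a w.

Lemma fg_submodule_span (M : lmodType A) n (x : 'I_n -> M) (P : M -> Prop) :
  noetherian_ring A -> P 0 -> (forall a u v, P u -> P v -> P (a *: u + v)) ->
  (forall y, P y -> exists c : 'I_n -> A, y = \sum_i c i *: x i) ->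
  exists k (z : 'I_k -> M), (forall i, P (z i)) /\
    forall y, P y -> exists c : 'I_k -> A, y = \sum_i c i *: z i.
Proof.
move=> noeth; elim: n x P => [|n IHn] x P P0 PD Px.
  exists 0%N, (fun=> 0); split=> [[]//|y /Px [c ->]].
  by exists (fun=> 0); rewrite !big_ord0.
pose x' i := x (lift ord0 i).
pose lead a (y : M) :=
  P y /\ exists c : 'I_n -> A, y = a *: x ord0 + \sum_i c i *: x' i.
have leadD a b c u v : lead a u -> lead b v -> lead (c * a + b) (c *: u + v).
  move=> [Pu [cu Eu]] [Pv [cv Ev]]; split; first exact: PD.
  exists (fun i => c * cu i + cv i); rewrite Eu Ev scalerDr scalerA scaler_sumr.
  rewrite addrACA -scalerDl -big_split /=; congr (_ + _).
  by apply: eq_bigr => i _; rewrite scalerDl scalerA.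
have lead0 : lead 0 0.
  split=> //; exists (fun=> 0); rewrite scale0r add0r big1 // => i _.
  by rewrite scale0r.
pose I : {pred A} := fun a => `[< exists y, lead a y >].
have memI a : (a \in I) <-> exists y, lead a y.
  by rewrite unfold_in; split=> [/asboolP|H]; last exact/asboolP.
have [k [a [y [lead_ay gen_a]]]] : exists k (a : 'I_k -> A) (y : 'I_k -> M),
    (forall i, lead (a i) (y i)) /\
    forall b, b \in I -> exists c : 'I_k -> A, b = \sum_i c i * a i.
  case: (pselect (1 \in I)) => [/memI [y1 lead1]|I1].
    exists 1%N, (fun=> 1), (fun=> y1); split=> // b _.
    by exists (fun=> b); rewrite big_ord1 mulr1.
  have [|k [a genI]] := noeth I.
    split; [by apply/memI; exists 0 | exact/negP |].
    move=> b u v /memI [yu lu] /memI [yv lv]; apply/memI.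
    by exists (b *: yu + yv); exact: leadD.
  have aI i : exists y, lead (a i) y.
    apply/memI/genI; exists (fun j => (j == i)%:R).
    rewrite (bigD1 i) //= eqxx mul1r big1 ?addr0 // => j /negPf ->.
    by rewrite mul0r.
  have [y lead_ay] := choice aI.
  by exists k, a, y; split=> // b /genI.
have [|u v w [Pv [c1 E1]] [Pw [c2 E2]]||l [z [Pz gen_z]]] :=
    IHn x' (fun y => P y /\ exists c : 'I_n -> A, y = \sum_i c i *: x' i).
- by split=> //; exists (fun=> 0); rewrite big1 // => i _; rewrite scale0r.
- split; first exact: PD.
  exists (fun i => u * c1 i + c2 i); rewrite E1 E2 scaler_sumr -big_split /=.
  by apply: eq_bigr => i _; rewrite scalerDl scalerA.
- by move=> v [].
exists (k + l)%N, (fun i => match split i with inl j => y j | inr j => z j end).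
split=> [i|v Pv].
  by case: (split i) => j; [case: (lead_ay j) | case: (Pz j)].
have [c Ev] := Px v Pv.
have lead_v : lead (c ord0) v.
  by split=> //; exists (fun i => c (lift ord0 i)); rewrite Ev big_ord_recl.
have [b Eb] : exists b : 'I_k -> A, c ord0 = \sum_i b i * a i.
  by apply: gen_a; apply/memI; exists v.
have lead_s : lead (\sum_i b i * a i) (\sum_i b i *: y i).
  elim/big_rec2: _ => // i u1 u2 _ lead12; exact: leadD.
have [_ [c1 E1]] := leadD _ _ (-1) _ _ lead_s lead_v.
have [|c2 E2] := gen_z (-1 *: (\sum_i b i *: y i) + v).
  split; first by apply: PD => //; case: lead_s.
  by exists c1; rewrite [LHS]E1 Eb mulN1r addNr scale0r add0r.
exists (fun i => match split i with inl j => b j | inr j => c2 j end).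
rewrite big_split_ord /=.
have -> : v = \sum_i b i *: y i + (-1 *: (\sum_i b i *: y i) + v).
  by rewrite scaleN1r addNKr ?addrA ?subrr ?add0r.
rewrite {}E2; congr (_ + _); apply: eq_bigr => i _.
  by rewrite (unsplitK (inl i)).
by rewrite (unsplitK (inr i)).
Qed.

Lemma fg_cohomology_of_fg (L M N : lmodType A)
    (a : {linear L -> M}) (b : {linear M -> N}) :
  noetherian_ring A -> fg_module M -> fg_cohomology a b.
Proof.
move=> noeth [n [x gen_x]].
have [||y _|k [z [bz gen_z]]] :=
    @fg_submodule_span M n x (fun y => b y = 0) noeth.
- by rewrite raddf0.
- by move=> c u v bu bv; rewrite linearP bu bv scaler0 addr0.
- exact: gen_x.
exists k, z; split=> // y /gen_z [c ->].
by exists c, 0; rewrite raddf0 addr0.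
Qed.

End Modules.

(* Hom-sets are setoids: equality of morphisms is [heq], written f ~= g. *)
Record category := Category {
  obj :> Type;
  mor : obj -> obj -> Type;
  heq : forall X Y, mor X Y -> mor X Y -> Prop;
  idm : forall X, mor X X;
  hcomp : forall X Y Z, mor Y Z -> mor X Y -> mor X Z;
  heq_refl : forall X Y (f : mor X Y), heq f f;
  heq_sym : forall X Y (f g : mor X Y), heq f g -> heq g f;
  heq_trans : forall X Y (f g h : mor X Y), heq f g -> heq g h -> heq f h;
  hcomp_heq : forall X Y Z (g g' : mor Y Z) (f f' : mor X Y),
    heq g g' -> heq f f' -> heq (hcomp g f) (hcomp g' f');
  hcomp1 : forall X Y (f : mor X Y), heq (hcomp f (idm X)) f;
  h1comp : forall X Y (f : mor X Y), heq (hcomp (idm Y) f) f;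
  hcompA : forall X Y Z T (h : mor Z T) (g : mor Y Z) (f : mor X Y),
    heq (hcomp h (hcomp g f)) (hcomp (hcomp h g) f)
}.
Arguments idm {c} X.

Notation "f ~= g" := (heq f g) (at level 70, no associativity).
Notation "g \c f" := (hcomp g f) (at level 50, left associativity).

Definition is_iso (C : category) (X Y : C) (f : mor X Y) :=
  exists g : mor Y X, g \c f ~= idm X /\ f \c g ~= idm Y.

Lemma is_iso_id (C : category) (X : C) : is_iso (idm X).
Proof. by exists (idm X); split; exact: hcomp1. Qed.

Record functor (C D : category) := Functor {
  fobj :> C -> D;
  fmap : forall X Y : C, mor X Y -> mor (fobj X) (fobj Y);
  fmap_heq : forall (X Y : C) (f g : mor X Y), f ~= g -> fmap f ~= fmap g;
  fmap_id : forall X : C, fmap (idm X) ~= idm (fobj X);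
  fmap_comp : forall (X Y Z : C) (g : mor Y Z) (f : mor X Y),
    fmap (g \c f) ~= fmap g \c fmap f
}.

Lemma is_iso_fmap (C D : category) (F : functor C D) (X Y : C) (f : mor X Y) :
  is_iso f -> is_iso (fmap F f).
Proof.
move=> [g [gf fg]]; exists (fmap F g); split.
  apply: heq_trans (heq_sym (fmap_comp F g f)) _.
  exact: heq_trans (fmap_heq F gf) (fmap_id F X).
apply: heq_trans (heq_sym (fmap_comp F f g)) _.
exact: heq_trans (fmap_heq F fg) (fmap_id F Y).
Qed.

Program Definition functor_id (C : category) : functor C C :=
  @Functor C C (fun X => X) (fun _ _ f => f) _ _ _.
Next Obligation. by []. Qed.
Next Obligation. move=> C X; exact: heq_refl. Qed.
Next Obligation. move=> C X Y Z g f; exact: heq_refl. Qed.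

Program Definition functor_comp (C D E : category)
    (G : functor D E) (F : functor C D) : functor C E :=
  @Functor C E (fun X => G (F X)) (fun _ _ f => fmap G (fmap F f)) _ _ _.
Next Obligation. by move=> C D E G F X Y f g fg; do 2!apply: fmap_heq. Qed.
Next Obligation.
move=> C D E G F X; apply: heq_trans (fmap_id G _).
exact: fmap_heq (fmap_id F X).
Qed.
Next Obligation.
move=> C D E G F X Y Z g f; apply: heq_trans (fmap_comp G _ _).
exact: fmap_heq (fmap_comp F g f).
Qed.

Record nat_iso (C D : category) (F G : functor C D) := NatIso {
  nmap :> forall X : C, mor (F X) (G X);
  nmap_iso : forall X : C, is_iso (nmap X);
  nmap_natural : forall (X Y : C) (f : mor X Y),
    nmap Y \c fmap F f ~= fmap G f \c nmap X
}.

Definition equivalence (C D : category) (F : functor C D) :=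
  exists G : functor D C,
    inhabited (nat_iso (functor_comp G F) (functor_id C)) /\
    inhabited (nat_iso (functor_comp F G) (functor_id D)).

(* The data of a triangulated category.  The axioms TR1-TR4, which hold in the
   instances below, play no role in the notion of a triangulated equivalence.
   Sums of morphisms are not recorded either: they are determined by the
   biproducts of the category, and are preserved by every exact functor. *)
Record tri_category := TriCategory {
  tri_cat :> category;
  shift : functor tri_cat tri_cat;
  exact_triangle : forall X Y Z : tri_cat,
    mor X Y -> mor Y Z -> mor Z (shift X) -> Prop;
  exact_triangle_heq : forall (X Y Z : tri_cat) (f f' : mor X Y)
      (g g' : mor Y Z) (h h' : mor Z (shift X)),
    f ~= f' -> g ~= g' -> h ~= h' ->
    exact_triangle f g h -> exact_triangle f' g' h'
}.

Definition triangle_iso (C : category) (S : functor C C)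
    (X Y Z : C) (f : mor X Y) (g : mor Y Z) (h : mor Z (S X))
    (X' Y' Z' : C) (f' : mor X' Y') (g' : mor Y' Z') (h' : mor Z' (S X')) :=
  exists (a : mor X X') (b : mor Y Y') (c : mor Z Z'),
    [/\ is_iso a, is_iso b & is_iso c] /\
    [/\ b \c f ~= f' \c a, c \c g ~= g' \c b & fmap S a \c h ~= h' \c c].

Lemma triangle_iso_heq (C : category) (S : functor C C)
    (X Y Z : C) (f1 f2 : mor X Y) (g1 g2 : mor Y Z) (h1 h2 : mor Z (S X))
    (X' Y' Z' : C) (f' : mor X' Y') (g' : mor Y' Z') (h' : mor Z' (S X')) :
  f1 ~= f2 -> g1 ~= g2 -> h1 ~= h2 ->
  triangle_iso f1 g1 h1 f' g' h' -> triangle_iso f2 g2 h2 f' g' h'.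
Proof.
move=> f12 g12 h12 [a [b [c [isos [Ef Eg Eh]]]]]; exists a, b, c; split=> //.
split.
- exact: heq_trans (hcomp_heq (heq_refl _) (heq_sym f12)) Ef.
- exact: heq_trans (hcomp_heq (heq_refl _) (heq_sym g12)) Eg.
- exact: heq_trans (hcomp_heq (heq_refl _) (heq_sym h12)) Eh.
Qed.

Lemma triangle_iso_refl (C : category) (S : functor C C)
    (X Y Z : C) (f : mor X Y) (g : mor Y Z) (h : mor Z (S X)) :
  triangle_iso f g h f g h.
Proof.
exists (idm X), (idm Y), (idm Z); split; first by split; exact: is_iso_id.
split; try exact: heq_trans (h1comp _) (heq_sym (hcomp1 _)).
apply: heq_trans (hcomp_heq (fmap_id S X) (heq_refl _)) _.
exact: heq_trans (h1comp _) (heq_sym (hcomp1 _)).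
Qed.

Record exact_functor (T U : tri_category) := ExactFunctor {
  ef_functor :> functor T U;
  ef_shift :
    nat_iso (functor_comp ef_functor (shift T))
            (functor_comp (shift U) ef_functor);
  ef_exact : forall (X Y Z : T) (f : mor X Y) (g : mor Y Z)
      (h : mor Z (shift T X)),
    exact_triangle f g h ->
    exact_triangle (fmap ef_functor f) (fmap ef_functor g)
                   (ef_shift X \c fmap ef_functor h)
}.

Definition triangulated_equivalence (T U : tri_category)
  (F : exact_functor T U) := equivalence F.

Program Definition exact_comp (T U V : tri_category)
    (G : exact_functor U V) (F : exact_functor T U) : exact_functor T V :=
  @ExactFunctor T V (functor_comp G F)
    (@NatIso _ _ _ _ (fun X => ef_shift G (F X) \c fmap G (ef_shift F X)) _ _) _.
Next Obligation.
move=> T U V G F X.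
have [a' [a'a aa']] := nmap_iso (ef_shift G) (F X).
have [b' [b'b bb']] := is_iso_fmap G (nmap_iso (ef_shift F) X).
exists (b' \c a'); split.
  apply: heq_trans (heq_sym (hcompA _ _ _)) _.
  apply: heq_trans (hcomp_heq (heq_refl b') (hcompA _ _ _)) _.
  apply: heq_trans b'b; apply: hcomp_heq (heq_refl b') _.
  exact: heq_trans (hcomp_heq a'a (heq_refl _)) (h1comp _).
apply: heq_trans (heq_sym (hcompA _ _ _)) _.
apply: heq_trans (hcomp_heq (heq_refl _) (hcompA _ _ _)) _.
apply: heq_trans aa'; apply: hcomp_heq (heq_refl _) _.
exact: heq_trans (hcomp_heq bb' (heq_refl _)) (h1comp _).
Qed.
Next Obligation.
move=> T U V G F X Y f /=.
apply: heq_trans (heq_sym (hcompA _ _ _)) _.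
apply: heq_trans (hcomp_heq (heq_refl _) (heq_sym (fmap_comp G _ _))) _.
apply: heq_trans (hcomp_heq (heq_refl _)
                    (fmap_heq G (nmap_natural (ef_shift F) f))) _.
apply: heq_trans (hcomp_heq (heq_refl _) (fmap_comp G _ _)) _.
apply: heq_trans (hcompA _ _ _) _; apply: heq_trans (heq_sym (hcompA _ _ _)).
exact: hcomp_heq (nmap_natural (ef_shift G) (fmap F f)) (heq_refl _).
Qed.
Next Obligation.
move=> T U V G F X Y Z f g h fgh /=.
apply: exact_triangle_heq (ef_exact G (ef_exact F fgh)); try exact: heq_refl.
apply: heq_trans (hcomp_heq (heq_refl _) (fmap_comp G _ _)) _.
exact: hcompA.
Qed.

Section FullSubcategory.
Variables (T : tri_category) (P : T -> Prop).
Hypothesis P_shift : forall X, P X -> P (shift T X).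

Program Definition full_category : category :=
  @Category {X : T | P X} (fun X Y => mor (sval X) (sval Y))
    (fun _ _ f g => f ~= g) (fun X => idm (sval X)) (fun _ _ _ g f => g \c f)
    _ _ _ _ _ _ _.
Next Obligation. move=> *; exact: heq_refl. Qed.
Next Obligation. move=> *; exact: heq_sym. Qed.
Next Obligation. move=> X Y f g h; exact: heq_trans. Qed.
Next Obligation. move=> *; exact: hcomp_heq. Qed.
Next Obligation. move=> *; exact: hcomp1. Qed.
Next Obligation. move=> *; exact: h1comp. Qed.
Next Obligation. move=> *; exact: hcompA. Qed.

Program Definition full_shift : functor full_category full_category :=
  @Functor full_category full_category
    (fun X => exist P (shift T (sval X)) (P_shift (svalP X)))
    (fun _ _ f => fmap (shift T) f) _ _ _.
Next Obligation. move=> X Y f g; exact: (@fmap_heq _ _ (shift T)). Qed.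
Next Obligation. move=> X; exact: (@fmap_id _ _ (shift T)). Qed.
Next Obligation. move=> X Y Z g f; exact: (@fmap_comp _ _ (shift T)). Qed.

Program Definition full_tri : tri_category :=
  @TriCategory full_category full_shift
    (fun X Y Z f g h => @exact_triangle T (sval X) (sval Y) (sval Z) f g h) _.
Next Obligation. move=> X Y Z f f' g g' h h'; exact: exact_triangle_heq. Qed.

End FullSubcategory.

Section FullInclusion.
Variables (T : tri_category) (P Q : T -> Prop).
Hypotheses (P_shift : forall X, P X -> P (shift T X))
           (Q_shift : forall X, Q X -> Q (shift T X))
           (PQ : forall X, P X -> Q X).

Program Definition full_incl_functor :
    functor (full_tri P_shift) (full_tri Q_shift) :=
  @Functor (full_tri P_shift) (full_tri Q_shift)
    (fun X => exist Q (sval X) (PQ (svalP X))) (fun _ _ f => f) _ _ _.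
Next Obligation. by []. Qed.
Next Obligation. move=> X; exact: heq_refl. Qed.
Next Obligation. move=> X Y Z g f; exact: heq_refl. Qed.

Program Definition full_incl :
    exact_functor (full_tri P_shift) (full_tri Q_shift) :=
  @ExactFunctor _ _ full_incl_functor
    (@NatIso _ _ _ _ (fun X => idm (shift T (sval X))) _ _) _.
Next Obligation.
by move=> X; exists (idm (shift T (sval X))); split; exact: hcomp1.
Qed.
Next Obligation.
by move=> X Y f; exact: heq_trans (h1comp _) (heq_sym (hcomp1 _)).
Qed.
Next Obligation.
move=> X Y Z f g h /= fgh; apply: exact_triangle_heq fgh; try exact: heq_refl.
exact: heq_sym (h1comp _).
Qed.

End FullInclusion.

(* The localization C[S^-1]: morphisms are the formal composites of morphisms
   of C and of inverses of the elements of S, modulo the congruence generated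
   by the relations of C and by s^-1 s = 1, s s^-1 = 1. *)
Section Localization.
Variables (C : category) (S : forall X Y : C, mor X Y -> Prop).

Inductive loc_term : C -> C -> Type :=
| loc_mor X Y (f : mor X Y) : loc_term X Y
| loc_inv X Y (s : mor X Y) (Ss : S s) : loc_term Y X
| loc_comp X Y Z (v : loc_term Y Z) (u : loc_term X Y) : loc_term X Z.

Inductive loc_heq : forall X Y, loc_term X Y -> loc_term X Y -> Prop :=
| loc_refl X Y (u : loc_term X Y) : loc_heq u u
| loc_sym X Y (u v : loc_term X Y) : loc_heq u v -> loc_heq v u
| loc_trans X Y (u v w : loc_term X Y) :
    loc_heq u v -> loc_heq v w -> loc_heq u w
| loc_comp_heq X Y Z (v v' : loc_term Y Z) (u u' : loc_term X Y) :
    loc_heq v v' -> loc_heq u u' -> loc_heq (loc_comp v u) (loc_comp v' u')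
| loc_assoc X Y Z T (w : loc_term Z T) (v : loc_term Y Z) (u : loc_term X Y) :
    loc_heq (loc_comp w (loc_comp v u)) (loc_comp (loc_comp w v) u)
| loc_id_r X Y (u : loc_term X Y) : loc_heq (loc_comp u (loc_mor (idm X))) u
| loc_id_l X Y (u : loc_term X Y) : loc_heq (loc_comp (loc_mor (idm Y)) u) u
| loc_mor_heq X Y (f g : mor X Y) : f ~= g -> loc_heq (loc_mor f) (loc_mor g)
| loc_mor_comp X Y Z (g : mor Y Z) (f : mor X Y) :
    loc_heq (loc_mor (g \c f)) (loc_comp (loc_mor g) (loc_mor f))
| loc_inv_l X Y (s : mor X Y) (Ss : S s) :
    loc_heq (loc_comp (loc_inv Ss) (loc_mor s)) (loc_mor (idm X))
| loc_inv_r X Y (s : mor X Y) (Ss : S s) :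
    loc_heq (loc_comp (loc_mor s) (loc_inv Ss)) (loc_mor (idm Y)).

Definition loc_category : category :=
  @Category C loc_term loc_heq (fun X => loc_mor (idm X)) loc_comp
    loc_refl loc_sym loc_trans loc_comp_heq loc_id_r loc_id_l loc_assoc.

Definition loc_functor : functor C loc_category :=
  @Functor C loc_category (fun X => X) loc_mor
    loc_mor_heq (fun X => loc_refl _) loc_mor_comp.

Variable F : functor C C.
Hypothesis FS : forall (X Y : C) (s : mor X Y), S s -> S (fmap F s).

Fixpoint loc_fmap X Y (u : loc_term X Y) : loc_term (F X) (F Y) :=
  match u with
  | loc_mor _ _ f => loc_mor (fmap F f)
  | loc_inv _ _ _ Ss => loc_inv (FS Ss)
  | loc_comp _ _ _ v u => loc_comp (loc_fmap v) (loc_fmap u)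
  end.

Lemma loc_fmap_heq X Y (u v : loc_term X Y) :
  loc_heq u v -> loc_heq (loc_fmap u) (loc_fmap v).
Proof.
elim=> {X Y u v} /=.
- move=> *; exact: loc_refl.
- move=> *; exact: loc_sym.
- move=> X Y u v w _ uv _ vw; exact: loc_trans uv vw.
- move=> *; exact: loc_comp_heq.
- move=> *; exact: loc_assoc.
- move=> X Y u; apply: loc_trans (loc_id_r _).
  exact/loc_comp_heq/loc_mor_heq/fmap_id/loc_refl.
- move=> X Y u; apply: loc_trans (loc_id_l _).
  exact: loc_comp_heq (loc_mor_heq (fmap_id F Y)) (loc_refl _).
- move=> X Y f g fg; exact/loc_mor_heq/fmap_heq.
- move=> X Y Z g f.
  exact: loc_trans (loc_mor_heq (fmap_comp F g f)) (loc_mor_comp _ _).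
- move=> X Y s Ss; apply: loc_trans (loc_inv_l _) _.
  exact/loc_mor_heq/heq_sym/fmap_id.
- move=> X Y s Ss; apply: loc_trans (loc_inv_r _) _.
  exact/loc_mor_heq/heq_sym/fmap_id.
Qed.

Definition loc_endo : functor loc_category loc_category :=
  @Functor loc_category loc_category F loc_fmap loc_fmap_heq
    (fun X => loc_mor_heq (fmap_id F X)) (fun X Y Z v u => loc_refl _).

End Localization.

(* A triangle of T[S^-1] is exact if it is isomorphic to the image of an exact
   triangle of T. *)
Section TriangulatedLocalization.
Variables (T : tri_category) (S : forall X Y : T, mor X Y -> Prop).
Hypothesis S_shift : forall (X Y : T) (s : mor X Y), S s -> S (fmap (shift T) s).
Let Q := loc_functor S.

Definition loc_exact (X Y Z : loc_category S) (f : mor X Y) (g : mor Y Z)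
    (h : mor Z (loc_endo S_shift X)) :=
  exists (X' Y' Z' : T) (f' : mor X' Y') (g' : mor Y' Z')
         (h' : mor Z' (shift T X')),
    exact_triangle f' g' h' /\
    @triangle_iso _ (loc_endo S_shift) _ _ _ f g h
                  (Q X') (Q Y') (Q Z') (fmap Q f') (fmap Q g') (fmap Q h').

Program Definition loc_tri : tri_category :=
  @TriCategory (loc_category S) (loc_endo S_shift) loc_exact _.
Next Obligation.
move=> X Y Z f f' g g' h h' ff' gg' hh' [X0 [Y0 [Z0 [f0 [g0 [h0 [ex iso]]]]]]].
exists X0, Y0, Z0, f0, g0, h0; split=> //.
exact: (triangle_iso_heq ff' gg' hh' iso).
Qed.

Program Definition loc_quotient : exact_functor T loc_tri :=
  @ExactFunctor T loc_tri Q
    (@NatIso _ _ _ _ (fun X => @idm (loc_category S) (shift T X)) _ _) _.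
Next Obligation. move=> X; exact: is_iso_id. Qed.
Next Obligation.
move=> X Y f; exact: heq_trans (h1comp _) (heq_sym (hcomp1 _)).
Qed.
Next Obligation.
move=> X Y Z f g h fgh; exists X, Y, Z, f, g, h; split=> //.
apply: triangle_iso_heq (triangle_iso_refl _ _ _); try exact: heq_refl.
exact: heq_sym (h1comp _).
Qed.

End TriangulatedLocalization.

Section TwoPeriodicComplexes.
Variable A : comNzRingType.

(* A 2-periodic complex is determined by X^0 = ev X, X^1 = od X and the two
   differentials d0 : X^0 -> X^1 and d1 : X^1 -> X^2 = X^0. *)
Record cpx2 := Cpx2 {
  ev : lmodType A;
  od : lmodType A;
  d0 : {linear ev -> od};
  d1 : {linear od -> ev};
  d1d0 : forall x, d1 (d0 x) = 0;
  d0d1 : forall x, d0 (d1 x) = 0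
}.

Record map2 (X Y : cpx2) := Map2 {
  m0 : {linear ev X -> ev Y};
  m1 : {linear od X -> od Y};
  m1_d0 : forall x, m1 (d0 X x) = d0 Y (m0 x);
  m0_d1 : forall x, m0 (d1 X x) = d1 Y (m1 x)
}.

Definition homotopic2 (X Y : cpx2) (f g : map2 X Y) :=
  exists (s0 : {linear ev X -> od Y}) (s1 : {linear od X -> ev Y}),
    (forall x, m0 f x - m0 g x = d1 Y (s0 x) + s1 (d0 X x)) /\
    (forall x, m1 f x - m1 g x = d0 Y (s1 x) + s0 (d1 X x)).

Definition id2 (X : cpx2) : map2 X X :=
  @Map2 X X idfun idfun (fun _ => erefl) (fun _ => erefl).

Program Definition comp2 (X Y Z : cpx2) (g : map2 Y Z) (f : map2 X Y) :
    map2 X Z :=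
  @Map2 X Z (m0 g \o m0 f) (m1 g \o m1 f) _ _.
Next Obligation. by move=> X Y Z g f x /=; rewrite !m1_d0. Qed.
Next Obligation. by move=> X Y Z g f x /=; rewrite !m0_d1. Qed.

Lemma eq_homotopic2 (X Y : cpx2) (f g : map2 X Y) :
  m0 f =1 m0 g -> m1 f =1 m1 g -> homotopic2 f g.
Proof.
move=> e0 e1; exists \0, \0.
by split=> x /=; rewrite (e0, e1) subrr linear0 addr0.
Qed.

Lemma homotopic2_sym (X Y : cpx2) (f g : map2 X Y) :
  homotopic2 f g -> homotopic2 g f.
Proof.
move=> [s0 [s1 [e0 e1]]]; exists (\- s0), (\- s1).
by split=> x /=; rewrite linearN -opprD -(e0, e1) opprB.
Qed.

Lemma homotopic2_trans (X Y : cpx2) (f g h : map2 X Y) :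
  homotopic2 f g -> homotopic2 g h -> homotopic2 f h.
Proof.
move=> [s0 [s1 [e0 e1]]] [t0 [t1 [k0 k1]]].
exists (s0 \+ t0), (s1 \+ t1); split=> x /=.
  by rewrite linearD addrACA -e0 -k0 addrA subrK.
by rewrite linearD addrACA -e1 -k1 addrA subrK.
Qed.

Lemma homotopic2_comp (X Y Z : cpx2) (g g' : map2 Y Z) (f f' : map2 X Y) :
  homotopic2 g g' -> homotopic2 f f' -> homotopic2 (comp2 g f) (comp2 g' f').
Proof.
move=> [t0 [t1 [k0 k1]]] [s0 [s1 [e0 e1]]].
exists ((m1 g \o s0) \+ (t0 \o m0 f')), ((m0 g \o s1) \+ (t1 \o m1 f')).
split=> x /=.
  rewrite -[LHS](subrKA (m0 g (m0 f' x))) -linearB e0 k0 !linearD /=.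
  by rewrite m1_d0 -m0_d1 addrACA.
rewrite -[LHS](subrKA (m1 g (m1 f' x))) -linearB e1 k1 !linearD /=.
by rewrite m0_d1 -m1_d0 addrACA.
Qed.

Definition K2_category : category :=
  @Category cpx2 map2 homotopic2 id2 comp2
    (fun X Y f => eq_homotopic2 (frefl (m0 f)) (frefl (m1 f)))
    homotopic2_sym homotopic2_trans homotopic2_comp
    (fun X Y f => eq_homotopic2 (fun _ => erefl) (fun _ => erefl))
    (fun X Y f => eq_homotopic2 (fun _ => erefl) (fun _ => erefl))
    (fun X Y Z T h g f => eq_homotopic2 (fun _ => erefl) (fun _ => erefl)).

Program Definition shift2 (X : cpx2) : cpx2 :=
  @Cpx2 (od X) (ev X) (\- d1 X) (\- d0 X) _ _.
Next Obligation. by move=> X x /=; rewrite linearN opprK d0d1. Qed.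
Next Obligation. by move=> X x /=; rewrite linearN opprK d1d0. Qed.

Program Definition shift2_map (X Y : cpx2) (f : map2 X Y) :
    map2 (shift2 X) (shift2 Y) :=
  @Map2 (shift2 X) (shift2 Y) (m1 f) (m0 f) _ _.
Next Obligation. by move=> X Y f x /=; rewrite linearN m0_d1. Qed.
Next Obligation. by move=> X Y f x /=; rewrite linearN m1_d0. Qed.

Program Definition K2_shift : functor K2_category K2_category :=
  @Functor K2_category K2_category shift2 shift2_map _ _ _.
Next Obligation.
move=> X Y f g [s0 [s1 [e0 e1]]]; exists (\- s1), (\- s0).
by split=> x /=; rewrite (e0, e1) !linearN !opprK.
Qed.
Next Obligation. by move=> X; exact: eq_homotopic2. Qed.
Next Obligation. by move=> X Y Z g f; exact: eq_homotopic2. Qed.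

Section ConeDifferential.
Variables (U V M N : lmodType A).
Variables (dX : {linear U -> V}) (dY : {linear M -> N}) (f : {linear U -> N}).

Definition cone_d (p : U * M) : V * N := (- dX p.1, dY p.2 - f p.1).

Lemma cone_d_is_linear : linear cone_d.
Proof.
move=> a [u m] [u' m']; rewrite /cone_d /=; congr (_, _) => /=.
  by rewrite linearP opprD scalerN.
by rewrite (linearP dY) (linearP f) opprD addrACA scalerBr.
Qed.

HB.instance Definition _ :=
  GRing.isLinear.Build A (U * M)%type (V * N)%type _ cone_d cone_d_is_linear.

End ConeDifferential.

Definition inr_lin (M N : lmodType A) (y : N) : M * N := (0, y).

Lemma inr_lin_is_linear (M N : lmodType A) : linear (@inr_lin M N).
Proof. by move=> a u v; congr (_, _); rewrite /= scaler0 addr0. Qed.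

HB.instance Definition _ (M N : lmodType A) :=
  GRing.isLinear.Build A N (M * N)%type _ (@inr_lin M N)
    (@inr_lin_is_linear M N).

Section Cone.
Variables (X Y : cpx2) (f : map2 X Y).

Program Definition cone2 : cpx2 :=
  @Cpx2 (od X * ev Y)%type (ev X * od Y)%type
    (cone_d (d1 X) (d0 Y) (m1 f)) (cone_d (d0 X) (d1 Y) (m0 f)) _ _.
Next Obligation.
move=> [x y]; rewrite /= /cone_d /=; congr (_, _) => /=.
  by rewrite linearN opprK d0d1.
by rewrite linearB linearN d1d0 m0_d1 sub0r opprK addNr.
Qed.
Next Obligation.
move=> [x y]; rewrite /= /cone_d /=; congr (_, _) => /=.
  by rewrite linearN opprK d1d0.
by rewrite linearB linearN d0d1 m1_d0 sub0r opprK addNr.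
Qed.

(* The maps u : Y -> cone f, u(y) = (0, y), and v : cone f -> X[1],
   v(x, y) = - x. *)
Program Definition cone2_in : map2 Y cone2 :=
  @Map2 Y cone2 (@inr_lin (od X) (ev Y)) (@inr_lin (ev X) (od Y)) _ _.
Next Obligation.
by move=> y /=; rewrite /inr_lin /cone_d /=; congr (_, _) => /=;
  rewrite linear0 (oppr0, subr0).
Qed.
Next Obligation.
by move=> y /=; rewrite /inr_lin /cone_d /=; congr (_, _) => /=;
  rewrite linear0 (oppr0, subr0).
Qed.

Program Definition cone2_out : map2 cone2 (shift2 X) :=
  @Map2 cone2 (shift2 X) (\- fst) (\- fst) _ _.
Next Obligation. by move=> p /=; rewrite /= [in RHS]linearN. Qed.
Next Obligation. by move=> p /=; rewrite /= [in RHS]linearN. Qed.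

End Cone.

Definition K2_exact (X Y Z : K2_category) (f : mor X Y) (g : mor Y Z)
    (h : mor Z (K2_shift X)) :=
  exists (X' Y' : cpx2) (f' : map2 X' Y'),
    @triangle_iso K2_category K2_shift _ _ _ f g h
      X' Y' (cone2 f') f' (cone2_in f') (cone2_out f').

Program Definition K2_Mod : tri_category :=
  @TriCategory K2_category K2_shift K2_exact _.
Next Obligation.
move=> X Y Z f f' g g' h h' ff' gg' hh' [X0 [Y0 [f0 iso]]].
exists X0, Y0, f0; exact: (triangle_iso_heq ff' gg' hh' iso).
Qed.

(* K^2(proj A) and K^2_fg(Mod A) are realized as full subcategories of
   K^2(Mod A), with the exact triangles of K^2(Mod A) whose vertices they
   contain. *)
Definition proj_cpx2 (X : K2_Mod) := proj_module (ev X) /\ proj_module (od X).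

Lemma proj_cpx2_shift (X : K2_Mod) : proj_cpx2 X -> proj_cpx2 (shift K2_Mod X).
Proof. by case. Qed.

Definition K2_proj : tri_category := full_tri proj_cpx2_shift.

Definition fg_cpx2 (X : K2_Mod) :=
  fg_cohomology (d1 X) (d0 X) /\ fg_cohomology (d0 X) (d1 X).

Definition acyclic2 (X : cpx2) := exact_at (d1 X) (d0 X) /\ exact_at (d0 X) (d1 X).

Lemma fg_cohomologyN (L M N : lmodType A)
    (a : {linear L -> M}) (b : {linear M -> N}) :
  fg_cohomology a b -> fg_cohomology (\- a) (\- b).
Proof.
move=> [n [z [bz gen_z]]]; exists n, z; split=> [i|y] /=.
  by rewrite bz oppr0.
move=> /eqP; rewrite oppr_eq0 => /eqP /gen_z [c [w ->]].
by exists c, (- w); rewrite /= linearN opprK.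
Qed.

Lemma fg_cpx2_shift (X : K2_Mod) : fg_cpx2 X -> fg_cpx2 (shift K2_Mod X).
Proof. by case=> fg0 fg1; split; exact: fg_cohomologyN. Qed.

Definition K2_fg : tri_category := full_tri fg_cpx2_shift.

(* The Verdier quotient by the acyclic complexes is the localization at the
   morphisms whose cone is acyclic. *)
Definition acyclic_cone (X Y : K2_fg) (s : mor X Y) :=
  acyclic2 (@cone2 (sval X) (sval Y) s).

Lemma acyclic_cone_shift (X Y : K2_fg) (s : mor X Y) :
  acyclic_cone s -> acyclic_cone (fmap (shift K2_fg) s).
Proof.
move: X Y s => [X fgX] [Y fgY] s; rewrite /acyclic_cone /=.
case=> ex0 ex1; split=> -[x y] /= [dx dy].
- have [|[x' y'] /= [-> Ey]] := ex1 (x, - y).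
    rewrite /= /cone_d /= linearN; congr (_, _); last first.
      by rewrite -[RHS]dy.
    by rewrite -[d0 X x]opprK dx oppr0.
  exists (- x', y'); rewrite /= /cone_d /=; congr (_, _).
    by rewrite opprK linearN.
  by rewrite -[y]opprK Ey linearN opprB opprK addrC.
- have [|[x' y'] /= [-> Ey]] := ex0 (x, - y).
    rewrite /= /cone_d /= linearN; congr (_, _); last first.
      by rewrite -[RHS]dy.
    by rewrite -[d1 X x]opprK dx oppr0.
  exists (- x', y'); rewrite /= /cone_d /=; congr (_, _).
    by rewrite opprK linearN.
  by rewrite -[y]opprK Ey linearN opprB opprK addrC.
Qed.

Definition D2_fg : tri_category := loc_tri acyclic_cone_shift.

Definition D2_quotient : exact_functor K2_fg D2_fg :=
  loc_quotient acyclic_cone_shift.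

Lemma proj_cpx2_fg (X : K2_Mod) : noetherian_ring A -> proj_cpx2 X -> fg_cpx2 X.
Proof.
by move=> noeth [[fg0 _] [fg1 _]]; split; exact: fg_cohomology_of_fg.
Qed.

Definition phi (noeth : noetherian_ring A) : exact_functor K2_proj D2_fg :=
  exact_comp D2_quotient
    (full_incl proj_cpx2_shift fg_cpx2_shift (fun X => proj_cpx2_fg noeth)).

End TwoPeriodicComplexes.

Lemma regular_local_noetherian (A : comNzRingType) (m : {pred A}) :
  regular_local_ring m -> noetherian_ring A.
Proof. by case. Qed.

(* Main.v *)
From HB Require Import structures.
Require Import Defs.
From mathcomp Require Import all_boot all_order all_algebra.
From mathcomp Require Import boolp classical_sets ring.
From Stdlib Require Import Setoid Morphisms.

(* Call a 2-periodic complex P K-projective if every map from P to an acyclic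
   complex is null-homotopic; the objects of K^2(proj A) then embed fully
   faithfully into D^2_fg(A) as soon as they are all K-projective, and the
   embedding is essentially surjective as soon as every X in K^2_fg(Mod A)
   receives a quasi-isomorphism from a K-projective complex of finitely generated
   projectives.

   Both facts rest on the finiteness of free resolutions over A.  The generators
   of m form a regular sequence: by the principal ideal theorem a chain of primes
   of length d can be moved to one of length d - 1 through x_1, so that by
   induction on d the sequence is regular modulo the bottom prime p of the chain;
   then p = m p, and p = 0.  Given an infinite exact sequence of matrices over A,
   one descends from A / m, where each matrix D has a generalized inverse
   (D E D = D), to A by lifting generalized inverses along each regular element.
   In a minimal resolution a generalized inverse forces a term to vanish.

   To resolve X, cover its cohomology by a complex F of finitely generated free
   modules with zero differential.  The cohomology of the cone of F -> X is the
   first syzygy, so iterating this reaches an acyclic cone, and X is resolved by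
   an iterated extension of complexes with zero differential, which is K-projective.
   Resolving in this way a complex of projectives, the cone is acyclic with
   projective terms; one of its two differentials has a generalized inverse, hence
   it is contractible, and the given complex is itself K-projective. *)

Set Implicit Arguments.
Unset Strict Implicit.
Unset Printing Implicit Defensive.

Import GRing.Theory.
Local Open Scope classical_set_scope.
Local Open Scope ring_scope.

(** * Regular sequences in regular local rings *)

Section Ideals.
Variable A : comNzRingType.
Implicit Types (I J K L P Q : set A) (a b c x y : A).

Definition is_ideal I := I 0 /\ forall a u v, I u -> I v -> I (a * u + v).

Definition is_prime P :=
  [/\ is_ideal P, ~ P 1 & forall a b, P (a * b) -> P a \/ P b].

Definition adjoin I x : set A := [set a | exists u c, I u /\ a = u + c * x].

Fixpoint adjoin_seq I (s : seq A) :=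
  if s is x :: s' then adjoin_seq (adjoin I x) s' else I.

(** The contraction to [A] of the extension of [I] to the local ring [A_P]; arguments over [A_P]
    thus stay inside [A]. *)
Definition saturation P I : set A := [set a | exists s, ~ P s /\ I (s * a)].

Lemma ideal0 I : is_ideal I -> I 0. Proof. by case. Qed.

Lemma ideal_mulD I a b c : is_ideal I -> I b -> I c -> I (a * b + c).
Proof. by case=> _; apply. Qed.

Lemma idealD I a b : is_ideal I -> I a -> I b -> I (a + b).
Proof. by case=> _ IP Ia Ib; rewrite -[a]mul1r; exact: IP. Qed.

Lemma ideal_mull I a b : is_ideal I -> I b -> I (a * b).
Proof. by case=> I0 IP Ib; rewrite -[_ * _]addr0; exact: IP. Qed.

Lemma ideal_mulr I a b : is_ideal I -> I a -> I (a * b).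
Proof. by rewrite mulrC; exact: ideal_mull. Qed.

Lemma idealN I a : is_ideal I -> I a -> I (- a).
Proof. by move=> iI Ia; rewrite -mulN1r; exact: ideal_mull. Qed.

Lemma idealB I a b : is_ideal I -> I a -> I b -> I (a - b).
Proof. by move=> iI Ia Ib; apply: idealD => //; exact: idealN. Qed.

Lemma ideal_sum I n (F : 'I_n -> A) :
  is_ideal I -> (forall i, I (F i)) -> I (\sum_i F i).
Proof.
by move=> iI IF; elim/big_ind: _ => //; [exact: ideal0 | move=> *; exact: idealD].
Qed.

Lemma prime_is_ideal P : is_prime P -> is_ideal P. Proof. by case. Qed.

Lemma prime_notinM P a b : is_prime P -> ~ P a -> ~ P b -> ~ P (a * b).
Proof. by case=> _ _ PM nPa nPb /PM []. Qed.

Lemma zero_ideal : is_ideal [set 0 : A].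
Proof. by split=> // c _ _ -> ->; rewrite /= mulr0 addr0. Qed.

Lemma adjoin_ideal I x : is_ideal I -> is_ideal (adjoin I x).
Proof.
move=> iI; split; first by exists 0, 0; split; [exact: ideal0 | ring].
move=> a _ _ [u [c [Iu ->]]] [v [d [Iv ->]]]; exists (a * u + v), (a * c + d).
by split; [exact: ideal_mulD | ring].
Qed.

Lemma sub_adjoin I x : I `<=` adjoin I x.
Proof. by move=> a Ia; exists a, 0; split=> //; ring. Qed.

Lemma adjoin_self I x : is_ideal I -> adjoin I x x.
Proof. by move=> iI; exists 0, 1; split; [exact: ideal0 | ring]. Qed.

Lemma adjoin_min I J x : is_ideal J -> I `<=` J -> J x -> adjoin I x `<=` J.
Proof.
by move=> iJ IJ Jx _ [u [c [/IJ Ju ->]]]; apply: idealD => //; exact: ideal_mull.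
Qed.

Lemma adjoinS I J x : I `<=` J -> adjoin I x `<=` adjoin J x.
Proof. by move=> IJ _ [u [c [/IJ Ju ->]]]; exists u, c. Qed.

Lemma adjoin_seq_ideal I s : is_ideal I -> is_ideal (adjoin_seq I s).
Proof. by elim: s I => //= x s IHs I iI; exact/IHs/adjoin_ideal. Qed.

Lemma sub_adjoin_seq I s : I `<=` adjoin_seq I s.
Proof. by elim: s I => [|x s IHs] I a Ia //=; exact/IHs/sub_adjoin. Qed.

Lemma adjoin_seqS I J s : I `<=` J -> adjoin_seq I s `<=` adjoin_seq J s.
Proof. by elim: s I J => //= x s IHs I J IJ; exact/IHs/adjoinS. Qed.

Lemma adjoin_seq_mem I s x : is_ideal I -> x \in s -> adjoin_seq I s x.
Proof.
elim: s I => //= y s IHs I iI; rewrite inE => /orP[/eqP ->|xs].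
  exact/sub_adjoin_seq/adjoin_self.
by apply: IHs => //; exact: adjoin_ideal.
Qed.

Lemma saturation_ideal P I : is_prime P -> is_ideal I -> is_ideal (saturation P I).
Proof.
move=> pP iI; split.
  by exists 1; split; [case: pP | rewrite mulr0; exact: ideal0].
move=> a u v [s [nPs Isu]] [t [nPt Itv]]; exists (s * t).
split; first exact: prime_notinM.
have -> : s * t * (a * u + v) = t * a * (s * u) + s * (t * v) by ring.
by apply: idealD => //; exact: ideal_mull.
Qed.

Lemma sub_saturation P I : is_prime P -> I `<=` saturation P I.
Proof. by case=> _ P1 _ a Ia; exists 1; rewrite mul1r. Qed.

Lemma saturated_saturation P I s a : is_prime P ->
  ~ P s -> saturation P I (s * a) -> saturation P I a.
Proof.
move=> pP nPs [t [nPt It]]; exists (t * s); split; first exact: prime_notinM.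
by rewrite -mulrA.
Qed.

(** * Maximal ideals of a family, Nakayama's lemma and the principal ideal theorem *)

Section Noetherian.
Hypothesis noeth : noetherian_ring A.

(** Without a maximal member, choice yields a strictly ascending chain; its union is finitely
    generated, and the generators already lie in one term. *)
Lemma noetherian_max (F : set (set A)) :
  (forall I, F I -> is_ideal I) -> (exists I, F I) ->
  exists2 M, F M & forall I, F I -> M `<=` I -> I `<=` M.
Proof.
move=> idF [I0 FI0]; apply: contrapT => noM.
have step (M : {I | F I}) : exists N : {I | F I},
    sval M `<=` sval N /\ ~ (sval N `<=` sval M).
  case: M => M FM; apply: contrapT => noN; apply: noM; exists M => // I FI MI.
  by apply: contrapT => nIM; apply: noN; exists (exist _ I FI).
have [f fP] := choice step.
pose c n := sval (iter n f (exist _ I0 FI0)).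
have ci n : is_ideal (c n) by rewrite /c; case: (iter n f _) => M /= /idF.
have cS n : c n `<=` c n.+1 by case: (fP (iter n f (exist _ I0 FI0))).
have cle m n : (m <= n)%N -> c m `<=` c n.
  move=> /subnK <-; elim: (n - m)%N => [//|k IHk] a ca.
  by rewrite addSn; apply: cS; exact: IHk.
have cN n : ~ (c n.+1 `<=` c n) by case: (fP (iter n f (exist _ I0 FI0))).
pose U : {pred A} := fun a => `[< exists n, c n a >].
have UP a : a \in U <-> exists n, c n a.
  by rewrite unfold_in; split=> [/asboolP|H]; last exact/asboolP.
have [|k [x genx]] := noeth (I := U).
  split.
  - by apply/UP; exists 0%N; exact: ideal0.
  (* [noetherian_ring] covers proper ideals only; a term containing [1] could not grow further. *)
  - apply/negP => /UP [n c1]; apply: (cN n) => a _.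
    by rewrite -[a]mulr1; exact: ideal_mull.
  move=> a u v /UP [n cu] /UP [p cv]; apply/UP; exists (maxn n p).
  case: (ci (maxn n p)) => _; apply.
    exact: (cle _ _ (leq_maxl n p)).
  exact: (cle _ _ (leq_maxr n p)).
have xU i : exists n, c n (x i).
  apply/UP/genx; exists (fun j => (j == i)%:R).
  rewrite (bigD1 i) //= eqxx mul1r big1 ?addr0 // => j /negPf ->.
  by rewrite mul0r.
have [h hP] := choice xU.
apply: (cN (\max_i h i)) => a ca.
have /genx [b ->] : a \in U by apply/UP; exists (\max_i h i).+1.
apply: ideal_sum => // i; apply: ideal_mull => //.
by apply: cle (hP i); exact: leq_bigmax.
Qed.

(* Nakayama's lemma localized at [P]; the first hypothesis says that [I] is
   contained in the saturation of [K + P * I]. *)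
Lemma nakayama_local P I K : is_prime P -> is_ideal K ->
  (forall L, is_ideal L -> K `<=` L -> (forall q x, I q -> P x -> L (q * x)) ->
     I `<=` saturation P L) ->
  I `<=` saturation P K.
Proof.
move=> pP iK IK; have iP := prime_is_ideal pP.
apply: contrapT => nIK.
have [||L [iL KL nIL] Lmax] := @noetherian_max
    [set L | [/\ is_ideal L, K `<=` L & ~ (I `<=` saturation P L)]].
- by move=> L [].
- by exists K; split.
have [t [It nLt]] : exists t, I t /\ ~ saturation P L t.
  apply: contrapT => H; apply: nIL => t It; apply: contrapT => nLt.
  by apply: H; exists t.
(* By maximality of [L], adding [t] captures all of [I] locally. *)
have satLt : I `<=` saturation P (adjoin L t).
  apply: contrapT => nI; apply: nLt; apply: sub_saturation => //.
  apply: (Lmax (adjoin L t)); [split | | exact: adjoin_self] => //.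
  - exact: adjoin_ideal.
  - by move=> a /KL; exact: sub_adjoin.
  - exact: sub_adjoin.
(* With [L' = L + P t] the hypothesis gives [s' * s * t = l + p * t]; as [s' * s - p] is outside
   [P], this puts [t] in the saturation of [L]. *)
pose L' : set A := [set a | exists l p, [/\ L l, P p & a = l + p * t]].
have iL' : is_ideal L'.
  split; first by exists 0, 0; split; [exact: ideal0 | exact: ideal0 | ring].
  move=> a _ _ [u [p [Lu Pp ->]]] [v [q [Lv Pq ->]]].
  exists (a * u + v), (a * p + q); split; last ring.
    exact: ideal_mulD.
  exact: ideal_mulD.
have LL' : L `<=` L'.
  by move=> l Ll; exists l, 0; split=> //; [exact: ideal0 | ring].
have [||s [nPs [s' [nPs' [l [p [Ll Pp E]]]]]]] :=
    IK _ (saturation_ideal pP iL') _ _ t It.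
- by move=> a /KL /LL'; exact: sub_saturation.
- move=> q x /satLt [s [nPs [l [c [Ll E]]]]] Px; exists s; split=> //.
  rewrite mulrA E; exists (l * x), (c * x); split; last ring.
    exact: ideal_mulr.
  exact: ideal_mull.
apply: nLt; exists (s' * s - p); split.
  move=> Psp; apply: (prime_notinM pP nPs' nPs).
  by rewrite -[s' * s](subrK p); exact: idealD.
by rewrite mulrBl -mulrA E addrK.
Qed.

Section PrincipalIdealTheorem.
Variables (P L0 : set A).
Hypotheses (pP : is_prime P) (iL0 : is_ideal L0).
Hypothesis Pmin : forall Q, is_prime Q -> L0 `<=` Q -> Q `<=` P -> P `<=` Q.

(** A maximal annihilator of a nonzero element of [A_P / L A_P] is a prime between [L0] and [P],
    hence equals [P] by [Pmin]. *)
Lemma ex_socle L : is_ideal L -> L0 `<=` L -> ~ saturation P L 1 ->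
  exists g, ~ saturation P L g /\ forall p, P p -> saturation P L (p * g).
Proof.
move=> iL L0L nL1; have isL := saturation_ideal pP iL.
pose ann g : set A := [set a | saturation P L (a * g)].
have iann g : is_ideal (ann g).
  split; first by rewrite /ann /= mul0r; exact: ideal0.
  move=> a u v au av; rewrite /ann /= mulrDl -mulrA.
  by apply: idealD => //; exact: ideal_mull.
have [||_ [g nLg ->] gmax] := @noetherian_max
    [set I | exists2 g, ~ saturation P L g & I = ann g].
- by move=> _ [g _ ->].
- by exists (ann 1), 1.
exists g; split=> //; apply: (Pmin (Q := ann g)).
- split=> //; first by rewrite /ann /= mul1r.
  move=> a b abg; apply: contrapT => /not_orP [nag nbg].
  apply: nag; apply: (gmax (ann (b * g))).
  + by exists (b * g).
  + by move=> c cg; rewrite /ann /= mulrCA; exact: ideal_mull.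
  + by rewrite /ann /= mulrA.
- by move=> a /L0L La; apply: ideal_mulr => //; exact: sub_saturation.
- move=> a ag; apply: contrapT => nPa; apply: nLg.
  exact: saturated_saturation ag.
Qed.

(* [A_P / L0 A_P] is artinian. *)
Lemma descending_chain_stationary (I : nat -> set A) :
  (forall n, is_ideal (I n)) -> (forall n, L0 `<=` I n) ->
  (forall n s a, ~ P s -> I n (s * a) -> I n a) ->
  (forall n, I n.+1 `<=` I n) -> exists n, I n `<=` I n.+1.
Proof.
move=> iI L0I satI decI.
have leI m n : (m <= n)%N -> I n `<=` I m.
  move=> /subnK <-; elim: (n - m)%N => [//|k IHk] a.
  by rewrite addSn => /decI; exact: IHk.
(* Noetherian induction: [L] is maximal such that the traces of the [I k] on [L] become stationary.
   A socle element modulo [L] would enlarge it. *)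
have [||L [iL L0L [n nP]] Lmax] := @noetherian_max
    [set L | [/\ is_ideal L, L0 `<=` L & exists n, forall k a, (n <= k)%N ->
      I k a -> L a -> I k.+1 a]].
- by move=> L [].
- by exists L0; split=> //; exists 0%N => k a _ _; exact: L0I.
have [[s [nPs]]|/(ex_socle iL L0L) [g [nLg socg]]] :=
    pselect (saturation P L 1).
  rewrite mulr1 => Ls; exists n => a Ia; apply: (satI _ s) => //.
  by apply: nP => //; [exact: ideal_mull | exact: ideal_mulr].
case: nLg; apply: sub_saturation => //.
apply: (Lmax (adjoin L g)); [split | |]; last exact: adjoin_self.
- exact: adjoin_ideal.
- by move=> a /L0L; exact: sub_adjoin.
(* As [g] is a socle element, the image of [I k] in [(L + (g)) / L] is locally zero or everything;
   from [n0] on it no longer changes. *)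
- have [c0 Pc0] : exists n0, forall k a l c, (n0 <= k)%N -> I k a -> L l ->
      a = l + c * g -> ~ P c -> exists a' l' c',
      [/\ I k.+1 a', L l', a' = l' + c' * g & ~ P c'].
    have [/existsNP [k0 nB]|allB] := pselect (~ forall k, exists a' l' c',
        [/\ I k.+1 a', L l', a' = l' + c' * g & ~ P c']).
      exists k0.+1 => k a l c k0k Ia Ll Ea nPc; case: nB; exists a, l, c.
      by split=> //; exact: leI Ia.
    by exists 0%N => k *; apply: (contrapT allB).
  exists (maxn n c0) => k a; rewrite geq_max => /andP[nk c0k] Ia.
  move=> [l [c [Ll Ea]]].
  have [Pc|nPc] := pselect (P c).
    have [s [nPs Lscg]] := socg c Pc; apply: (satI _ s) => //.
    apply: nP => //; first exact: ideal_mull.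
    by rewrite Ea mulrDr; apply: idealD => //; exact: ideal_mull.
  have [a' [l' [c' [Ia' Ll' Ea' nPc']]]] := Pc0 k a l c c0k Ia Ll Ea nPc.
  apply: (satI _ c') => //.
  (* The combination [c' * a - c * a'] cancels [g] and falls into [L], where the chain is
     stationary. *)
  rewrite -[c' * a](subrK (c * a')); apply: idealD => //; last exact: ideal_mull.
  apply: nP => //.
    apply: idealB => //; apply: ideal_mull => //; exact: decI.
  have -> : c' * a - c * a' = c' * l - c * l' by rewrite Ea Ea'; ring.
  by apply: idealB => //; exact: ideal_mull.
- exact: sub_adjoin.
Qed.

End PrincipalIdealTheorem.

(* Krull's principal ideal theorem: otherwise [P] is minimal over [p0 + (x)].
   For [y] in [p1], the [p1]-saturations of [p0 + (y^n)] then become stationary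
   modulo [x] and, by Nakayama's lemma, stationary at [P]. *)
Lemma prime_between p0 p1 P x :
  is_prime p0 -> is_prime p1 -> is_prime P ->
  p0 `<=` p1 -> ~ (p1 `<=` p0) -> p1 `<=` P -> P x -> ~ p1 x ->
  exists Q, [/\ is_prime Q, p0 `<=` Q, Q x, Q `<=` P & ~ (P `<=` Q)].
Proof.
move=> pp0 pp1 pP p01 np10 p1P Px np1x; apply: contrapT => noQ.
have [[ip0 ip1] iP] := (prime_is_ideal pp0, prime_is_ideal pp1, prime_is_ideal pP).
have Pmin Q : is_prime Q -> adjoin p0 x `<=` Q -> Q `<=` P -> P `<=` Q.
  move=> pQ p0xQ QP; apply: contrapT => nPQ; apply: noQ; exists Q; split=> //.
    by move=> a /(@sub_adjoin _ x) /p0xQ.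
  exact/p0xQ/adjoin_self.
have [y [p1y np0y]] : exists y, p1 y /\ ~ p0 y.
  apply: contrapT => noy; apply: np10 => y p1y; apply: contrapT => np0y.
  by apply: noy; exists y.
pose I n := saturation p1 (adjoin p0 (y ^+ n)).
have iI n : is_ideal (I n) by apply: saturation_ideal => //; exact: adjoin_ideal.
have p0I n : p0 `<=` I n by move=> a p0a; exact/sub_saturation/sub_adjoin.
have decI n : I n.+1 `<=` I n.
  move=> a [s [nPs [u [c [p0u E]]]]]; exists s; split=> //.
  by rewrite E exprS; exists u, (c * y); split=> //; ring.
have [|n|n s a|n a [s [nPs [u [c [Iu E]]]]]|n stat] :=
    @descending_chain_stationary P (adjoin p0 x) pP
      (adjoin_ideal x ip0) Pmin (fun n => saturation P (adjoin (I n) x)).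
- by move=> n; apply: saturation_ideal => //; exact: adjoin_ideal.
- by move=> a p0xa; apply: sub_saturation => //; exact: adjoinS p0xa.
- exact: saturated_saturation.
- by exists s; split=> //; rewrite E; exists u, c; split=> //; exact: decI.
have InS : I n `<=` I n.+1.
  (* Stationarity modulo [x] gives [s * a = u + c * x] with [u] in [I n.+1]; since [x] is outside
     [p1] and [I n] is saturated at [p1], [c] lies in [I n], and [c * x] in [P * I n]. *)
  have IK : I n `<=` saturation P (I n.+1).
    apply: nakayama_local => // L iL IL LP a Ia.
    have [|s [nPs [u [c [Iu E]]]]] := stat a.
      exact/sub_saturation/sub_adjoin.
    exists s; split=> //; rewrite E; apply: idealD => //; first exact: IL.
    apply: LP => //; apply: (@saturated_saturation p1 _ x) => //.
    have -> : x * c = s * a - u by rewrite E; ring.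
    by apply: (idealB (iI n)); [exact: (ideal_mull _ (iI n)) | exact: decI].
  move=> a /IK [s [nPs]]; apply: saturated_saturation => //.
  by move/p1P.
(* Now [y ^+ n * (s - c * y)] lies in the prime [p0] while [y] does not, so [s] would lie in
   [p1]. *)
have [|s [nps [u [c [p0u E]]]]] := InS (y ^+ n).
  exact/sub_saturation/adjoin_self.
apply: nps; rewrite -[s](subrK (c * y)); apply: idealD => //; last exact: ideal_mull.
apply: p01; have : p0 (y ^+ n * (s - c * y)).
  by have -> : y ^+ n * (s - c * y) = u; [rewrite mulrBr [_ * s]mulrC E exprS; ring |].
have np0yn : ~ p0 (y ^+ n).
  elim: (n) => [|k IHk]; first by case: pp0.
  by rewrite exprS; exact: prime_notinM.
by case: pp0 => _ _ p0M /p0M [].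
Qed.

(** * Chains of primes and regular sequences *)

Definition is_chain n (q : nat -> set A) :=
  (forall i, (i <= n)%N -> is_prime (q i)) /\
  (forall i, (i < n)%N -> q i `<=` q i.+1 /\ ~ (q i.+1 `<=` q i)).

Lemma is_chain_behead n q : is_chain n.+1 q -> is_chain n (fun i => q i.+1).
Proof. by case=> pq sq; split=> i ?; [exact: pq | exact: sq]. Qed.

Lemma is_chain_belast n q : is_chain n.+1 q -> is_chain n q.
Proof. by case=> pq sq; split=> i ?; [apply: pq | apply: sq]; exact: ltnW. Qed.

Lemma is_chain_rcons n q Q : is_chain n q -> is_prime Q -> q n `<=` Q ->
  ~ (Q `<=` q n) -> is_chain n.+1 (fun i => if (i <= n)%N then q i else Q).
Proof.
move=> [pq sq] pQ qQ nQq; split=> i; first by move=> _; case: leqP => // /pq.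
rewrite ltnS {1}leq_eqVlt => /orP[/eqP -> | lt_in]; first by rewrite leqnn ltnn.
by rewrite lt_in ltnW //; exact: sq.
Qed.

(** [prime_between] puts [x] into a prime just below the top one; the chain ending there is treated
    by induction, and the old top is put back. *)
Lemma is_chain_through n q x : is_chain n.+1 q -> q n.+1 x ->
  exists q', [/\ is_chain n q', q 0%N `<=` q' 0%N, q' 0%N x & q' n `<=` q n.+1].
Proof.
elim: n q => [|n IHn] q [pq sq] qx.
  exists (fun=> q 1%N); split=> //; last by case: (sq 0%N).
    by split=> // i _; exact: pq.
have [[q01 nq10] [q12 nq21]] := (sq n (leqnSn n.+1), sq n.+1 (leqnn _)).
have [Q [[pQ q0Q Qx Qq] [nqQ nQq]]] : exists Q,
    [/\ is_prime Q, q n `<=` Q, Q x & Q `<=` q n.+2] /\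
    ~ (q n.+2 `<=` Q) /\ ~ (Q `<=` q n).
  have [q1x|nq1x] := pselect (q n.+1 x).
    by exists (q n.+1); split=> //; split=> //; exact: pq.
  have [Q [pQ qQ Qx Qq nqQ]] := prime_between
    (pq n (leqW (leqnSn n))) (pq n.+1 (leqnSn _)) (pq n.+2 (leqnn _))
    q01 nq10 q12 qx nq1x.
  exists Q; split; [by [] | split=> // Qn].
  by apply: nq1x; exact/q01/Qn.
have [|q' [ch' le0 q'0x le_n]] :=
    IHn _ (is_chain_rcons (is_chain_belast (is_chain_belast (conj pq sq)))
      pQ q0Q nQq).
  by rewrite ltnn.
rewrite ltnn in le_n.
exists (fun i => if (i <= n)%N then q' i else q n.+2); split=> //.
- apply: is_chain_rcons => //; first exact: pq.
    by move=> a /le_n; exact: Qq.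
  by move=> qq'; apply: nqQ => a /qq'; exact: le_n.
- by rewrite ltnn.
Qed.

Fixpoint regular_seq J (s : seq A) :=
  if s is x :: s' then
    (forall a, J (x * a) -> J a) /\ regular_seq (adjoin J x) s'
  else True.

(* A sequence [s] regular modulo [P] is Tor-independent of [P]:
   [P] meets [J + (s)] in [J + P (s)]. *)
Lemma regular_seq_cap P J L s : regular_seq P s ->
  is_ideal P -> is_ideal L -> J `<=` L -> L `<=` P ->
  (forall p x, P p -> x \in s -> L (p * x)) ->
  forall a, P a -> adjoin_seq J s a -> L a.
Proof.
elim: s P J L => [|x s IHs] P J L; first by move=> _ _ _ JL _ _ a _ /JL.
move=> [regx regs] iP iL JL LP Ls a Pa Ja.
have [|||||||l [c [Ll Ea]]] := IHs _ (adjoin J x) (adjoin L x) regs _ _ _ _ _ a.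
- exact: adjoin_ideal.
- exact: adjoin_ideal.
- exact: adjoinS.
- exact: adjoinS.
- move=> _ y [u [c [Pu ->]]] ys; exists (u * y), (c * y); split; last ring.
  by apply: Ls => //; rewrite inE ys orbT.
- exact: sub_adjoin.
- exact: Ja.
(* Here [x * c = a - l] lies in [P], so regularity of [x] modulo [P] puts [c] in [P]. *)
rewrite Ea; apply: idealD => //; apply: Ls; last exact: mem_head.
apply: regx; have -> : x * c = a - l by rewrite Ea; ring.
by apply: idealB => //; exact: LP.
Qed.

Section Local.
Variable m : set A.
Hypotheses (pm : is_prime m) (unit_m : forall a, ~ m a -> exists b, a * b = 1).

Lemma prime_sub_max P : is_prime P -> P `<=` m.
Proof.
move=> [iP nP1 _] a Pa; apply: contrapT => /unit_m [b ab1]; apply: nP1.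
by rewrite -ab1; exact: ideal_mulr.
Qed.

(** By [regular_seq_cap], [P = J + m P]; Nakayama's lemma at [m] then gives [P = J], elements
    outside [m] being units. *)
Lemma regular_seq_cap_sub P J s : is_ideal P -> is_ideal J -> J `<=` P ->
  regular_seq P s -> P `<=` adjoin_seq J s -> (forall x, x \in s -> m x) ->
  P `<=` J.
Proof.
move=> iP iJ JP regs Ps sm a Pa.
have [||s' [/unit_m [b sb1] Jsa]] := @nakayama_local m P J pm iJ _ a.
- move=> L iL JL LPm {}a {}Pa; apply: sub_saturation => //.
  have [||||//] :=
      @regular_seq_cap P J (L `&` P) s regs iP _ _ _ _ a Pa (Ps a Pa).
  + split; first by split; exact: ideal0.
    by move=> c u v [Lu Pu] [Lv Pv]; split; exact: ideal_mulD.
  + by move=> u Ju; split; [exact: JL | exact: JP].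
  + by move=> u [].
  + move=> p x Pp /sm mx; split; first exact: LPm.
    exact: ideal_mulr.
- exact: Pa.
by have -> : a = b * (s' * a) by [rewrite mulrA [b * _]mulrC sb1 mul1r];
  exact: ideal_mull.
Qed.

(** The induction is over all [J] because it is applied both to [q 1] and to [q 0 + (x)]. *)
Lemma regular_seq_of_chain s J q : is_ideal J ->
  (forall x, x \in s -> m x) -> m `<=` adjoin_seq J s ->
  is_chain (size s) q -> J `<=` q 0%N -> regular_seq J s.
Proof.
elim: s J q => [//|x s IHs] J q iJ sm /= mJs chq Jq.
have mx : m x by apply: sm; rewrite mem_head.
have sm0 := sm; have {}sm y : y \in s -> m y by move=> ys; apply: sm; rewrite inE ys orbT.
have [pq sq] := chq; have [q01 nq10] := sq 0%N isT.
have [pq0 pq1] : is_prime (q 0%N) /\ is_prime (q 1%N) by split; exact: pq.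
have [iq0 iq1] := (prime_is_ideal pq0, prime_is_ideal pq1).
(* Otherwise [s] generates [m] modulo [q 0], and it is regular modulo [q 1] by induction, so [q 1]
   would lie in [q 0]. *)
have nq0x : ~ q 0%N x.
  move=> q0x; have Jxq0 := adjoin_min iq0 Jq q0x.
  apply: nq10; apply: (regular_seq_cap_sub iq1 iq0 q01 _ _ sm).
    apply: IHs (is_chain_behead chq) (@subset_refl _ _) => // a /mJs.
    by apply/adjoin_seqS => b /Jxq0; exact: q01.
  by move=> a /(prime_sub_max pq1) /mJs; exact: adjoin_seqS.
(* The top prime is first replaced by [m], which contains [x]. *)
have [q' [chq' qq' q'x _]] : exists q', [/\ is_chain (size s) q',
    q 0%N `<=` q' 0%N, q' 0%N x & q' (size s) `<=` m].
  have [lt1 nlt1] := sq (size s) (leqnn _).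
  have := is_chain_through (x := x)
    (is_chain_rcons (is_chain_belast (n := size s) chq) pm _ _).
  rewrite /= ltnn; apply=> //.
  - by move=> a /lt1; apply: prime_sub_max; exact: pq.
  - move=> mq; apply: nlt1 => a qa; apply: mq; apply: prime_sub_max qa.
    exact: pq.
have regq : regular_seq (q 0%N) (x :: s).
  split; first by move=> a; case: pq0 => _ _ qM /qM [].
  apply: (IHs _ q') => //; first exact: adjoin_ideal.
    by move=> a /mJs; exact/adjoin_seqS/adjoinS.
  by apply: adjoin_min => //; apply: prime_is_ideal; case: chq' => + _; apply.
(* Regularity modulo [q 0] forces [J] to be the bottom prime itself. *)
suff -> : J = q 0%N by [].
apply/seteqP; split=> //; apply: (regular_seq_cap_sub iq0 iJ Jq regq _ sm0).
by move=> a /(prime_sub_max pq0) /mJs.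
Qed.

End Local.
End Noetherian.

(** * From Boolean predicates to sets: local and regular local rings *)

Lemma idealr_closed_is_ideal (I : {pred A}) :
  idealr_closed I -> is_ideal [set a | a \in I] /\ 1 \notin I.
Proof. by case=> I0 I1 ID; split=> //; split=> // a u v; exact: ID. Qed.

Lemma is_ideal_idealr_closed I : is_ideal I -> ~ I 1 ->
  idealr_closed (fun a => `[< I a >] : bool).
Proof.
move=> iI nI1; split=> [||a u v]; rewrite !unfold_in.
- by apply/asboolP; exact: ideal0.
- by apply/negP => /asboolP.
- by move=> /asboolP Iu /asboolP Iv; apply/asboolP; exact: ideal_mulD.
Qed.

Lemma local_ring_unit (m : {pred A}) : noetherian_ring A -> local_ring m ->
  forall a, a \notin m -> exists b, a * b = 1.
Proof.
move=> noeth [_ locm] a nma; apply: contrapT => nua.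
have i0 := zero_ideal.
have [||M [iM nM1 Ma] Mmax] := @noetherian_max noeth
    [set I | [/\ is_ideal I, ~ I 1 & I a]].
- by move=> I [].
- exists (adjoin [set 0] a); split; [exact: adjoin_ideal | | exact: adjoin_self].
  by move=> [_ [c [-> E]]]; apply: nua; exists c; rewrite E; ring.
have /locm Mm : maximal_ideal (fun a => `[< M a >] : bool).
  split; first exact: is_ideal_idealr_closed.
  move=> J /[dup] /idealr_closed_is_ideal [iJ /negP nJ1] _ MJ b.
  have MJ' : M `<=` [set a | a \in J] by move=> c Mc; exact/MJ/asboolP.
  rewrite [RHS]unfold_in; apply/idP/asboolP; last exact: MJ'.
  by apply: (Mmax [set a | a \in J]) => //; split=> //; exact: MJ'.
by move: nma; rewrite -Mm => /negP; apply; exact/asboolP.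
Qed.

Lemma local_ring_prime (m : {pred A}) : noetherian_ring A -> local_ring m ->
  is_prime [set a | a \in m].
Proof.
move=> noeth locm; have [[/idealr_closed_is_ideal [im /negP m1] _] _] := locm.
split=> // a b /= mab; have [ma|nma] := boolP (a \in m); [by left | right].
have [c ac1] := local_ring_unit noeth locm nma.
have -> : b = c * (a * b) by rewrite mulrA [c * a]mulrC ac1 mul1r.
exact: (ideal_mull (I := [set a | a \in m])).
Qed.

(** The dimension provides a chain of primes exactly as long as the list [codom x] of generators of
    [m]. *)
Lemma regular_local_ring_regular_seq (m : {pred A}) : regular_local_ring m ->
  exists s, [/\ forall x, x \in s -> x \in m,
    [set a | a \in m] `<=` adjoin_seq [set 0] s & regular_seq [set 0] s].
Proof.
move=> [noeth locm [d [[[p [prime_p strict_p]] _] [x genx]]]].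
have i0 := zero_ideal.
have unit_m a : ~ [set a | a \in m] a -> exists b, a * b = 1.
  by move=> /negP; exact: local_ring_unit.
have mx y : y \in codom x -> y \in m.
  move=> /codomP [i ->]; apply/genx; exists (fun j => (j == i)%:R).
  rewrite (bigD1 i) //= eqxx mul1r big1 ?addr0 // => j /negPf ->.
  by rewrite mul0r.
have mgen : [set a | a \in m] `<=` adjoin_seq [set 0] (codom x).
  move=> a /genx [c ->]; have is0 := adjoin_seq_ideal (codom x) i0.
  apply: ideal_sum => // i; apply: ideal_mull => //.
  by apply: adjoin_seq_mem => //; exact: codom_f.
exists (codom x); split=> //.
apply: (regular_seq_of_chain noeth (local_ring_prime noeth locm) unit_m
          (q := fun i => [set a | a \in p i])) => //.
  rewrite size_codom card_ord; split=> i lei.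
    have [/idealr_closed_is_ideal [ip /negP p1] pM] := prime_p i lei.
    by split=> // a b /pM /orP.
  by have [sub nsub] := strict_p i lei; split=> [a|H]; [exact: sub | apply: nsub].
by move=> _ ->; have [/idealr_closed_is_ideal [[]]] := prime_p 0%N isT.
Qed.

End Ideals.

(** * Exact sequences of matrices *)

Section MatricesModuloIdeal.
Variables (A : comNzRingType) (J : set A).
Hypothesis iJ : is_ideal J.

(** Matrices over [A / J] are represented by matrices over [A], so that lifting along a regular
    element keeps the same matrices and only changes [J]. *)
Definition mxcong m n (M N : 'M[A]_(m, n)) := forall i j, J (M i j - N i j).

Local Notation "M === N" := (mxcong M N) (at level 70).

Lemma mxcong_refl m n (M : 'M[A]_(m, n)) : M === M.
Proof. by move=> i j; rewrite subrr; exact: ideal0. Qed.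

#[local] Hint Resolve mxcong_refl : core.

Lemma mxcong_sym m n (M N : 'M[A]_(m, n)) : M === N -> N === M.
Proof. by move=> MN i j; rewrite -opprB; exact: idealN. Qed.

Lemma mxcong_trans m n (M N P : 'M[A]_(m, n)) : M === N -> N === P -> M === P.
Proof.
move=> MN NP i j; have -> : M i j - P i j = (M i j - N i j) + (N i j - P i j).
  by ring.
exact: idealD.
Qed.

Lemma mxcongD m n (M M' N N' : 'M[A]_(m, n)) :
  M === M' -> N === N' -> M + N === M' + N'.
Proof.
move=> MM' NN' i j; rewrite !mxE opprD addrACA; exact: idealD.
Qed.

Lemma mxcongN m n (M N : 'M[A]_(m, n)) : M === N -> - M === - N.
Proof. by move=> MN i j; rewrite !mxE -opprD; exact: idealN. Qed.

Lemma mxcongZ m n a (M N : 'M[A]_(m, n)) : M === N -> a *: M === a *: N.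
Proof. by move=> MN i j; rewrite !mxE -mulrBr; exact: ideal_mull. Qed.

Lemma mxcongM m n p (M M' : 'M[A]_(m, n)) (N N' : 'M[A]_(n, p)) :
  M === M' -> N === N' -> M *m N === M' *m N'.
Proof.
move=> MM' NN' i j; rewrite !mxE -sumrB; apply: ideal_sum => // k.
have -> : M i k * N k j - M' i k * N' k j =
  (M i k - M' i k) * N k j + M' i k * (N k j - N' k j) by ring.
by apply: idealD => //; [exact: (ideal_mulr _ iJ (MM' i k)) | exact: (ideal_mull _ iJ (NN' k j))].
Qed.

#[local] Instance mxcong_equivalence m n : Equivalence (@mxcong m n).
Proof.
split; [exact: mxcong_refl | exact: mxcong_sym | exact: mxcong_trans].
Qed.
#[local] Instance mxcongD_proper m n :
  Proper (@mxcong m n ==> @mxcong m n ==> @mxcong m n) +%R.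
Proof. by move=> ? ? ? ? ? ?; exact: mxcongD. Qed.
#[local] Instance mxcongN_proper m n : Proper (@mxcong m n ==> @mxcong m n) -%R.
Proof. by move=> ? ? ?; exact: mxcongN. Qed.
#[local] Instance mxcongZ_proper m n a :
  Proper (@mxcong m n ==> @mxcong m n) ( *:%R a).
Proof. by move=> ? ? ?; exact: mxcongZ. Qed.
#[local] Instance mxcongM_proper m n p :
  Proper (@mxcong m n ==> @mxcong n p ==> @mxcong m p) mulmx.
Proof. by move=> ? ? ? ? ? ?; exact: mxcongM. Qed.

(** Von Neumann regularity over [A / J]: the row space of [D] is a direct summand, the image of the
    idempotent [E *m D]. *)
Definition regular_mod m n (D : 'M[A]_(m, n)) := exists E, D *m E *m D === D.

Definition exact_mod (r : nat -> nat) (D : forall i, 'M[A]_(r i.+1, r i)) :=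
  forall i, D i.+1 *m D i === 0 /\
    forall k (u : 'M[A]_(k, r i.+1)), u *m D i === 0 ->
      exists v, u === v *m D i.+1.

Lemma exact_modP r D i k (u : 'M[A]_(k, r i.+1)) : exact_mod D ->
  u *m D i === 0 -> exists v, u === v *m D i.+1.
Proof. by move=> /(_ i) [_]; apply. Qed.

(** The inverse modulo [x] is lifted not to [D i.+1] but to the next matrix [C]: exactness turns the
    error [x *: W] into [C *m (1%:M + x *: V) = - (C *m U *m C)] modulo [J], with an invertible
    factor on the left. *)
Lemma exact_mod_regular_inverse (r : nat -> nat) (D : forall i, 'M[A]_(r i.+1, r i)) i
    (x : A) (E : 'M[A]_(r i.+1, r i.+2)) W :
  exact_mod D -> (forall a, J (x * a) -> J a) ->
  (forall n (V : 'M[A]_n), exists G, (1%:M + x *: V) *m G = 1%:M) ->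
  D i.+1 *m E *m D i.+1 === D i.+1 + x *: W -> regular_mod (D i.+2).
Proof.
move=> exD regx inv1.
have CD : D i.+2 *m D i.+1 === 0 by case: (exD i.+1).
have DD' : D i.+1 *m D i === 0 by case: (exD i).
have divx m n (M : 'M[A]_(m, n)) : x *: M === 0 -> M === 0.
  by move=> xM k l; have := xM k l; rewrite !mxE !subr0; exact: regx.
move: DD' CD; set D1 := D i.+1; set D0 := D i; set C := D i.+2 => DD' CD DED.
have [V WVD] : exists V, W === V *m D1.
  apply: exact_modP exD _; apply: divx; rewrite scalemxAl.
  have -> : x *: W = D1 + x *: W - D1 by rewrite addrC addKr.
  by rewrite mulmxBl -DED -(mulmxA _ D1 (D i)) DD' mulmx0 subrr.
have [U EU] : exists U, D1 *m E - 1%:M - x *: V === U *m C.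
  apply: exact_modP exD _; rewrite !mulmxBl mul1mx DED -scalemxAl -WVD.
  by rewrite addrAC addrK subrr.
have CUC : C *m (1%:M + x *: V) === - (C *m U *m C).
  by rewrite -mulmxA -EU !mulmxBr mulmxA CD mul0mx sub0r -opprD opprK mulmxDr.
(* [V'] carries the factor [1%:M + x *: V] across [C], so that its inverse can be absorbed into the
   generalized inverse. *)
have [V' CV] : exists V', C *m V === V' *m C.
  apply: exact_modP exD _; rewrite -mulmxA -WVD; apply: divx.
  have -> : x *: (C *m W) = C *m (D1 + x *: W) - C *m D1.
    by rewrite mulmxDr addrAC subrr add0r scalemxAr.
  by rewrite -DED !mulmxA CD !mul0mx subrr.
have [G YG] := inv1 _ V; have [G' YG'] := inv1 _ V'.
have YC : C *m (1%:M + x *: V) === (1%:M + x *: V') *m C.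
  by rewrite mulmxDr mulmxDl mulmx1 mul1mx -scalemxAr -scalemxAl CV.
have GC : G' *m C === C *m G.
  rewrite -[X in X === _]mulmx1 -YG mulmxA -(mulmxA G') YC !mulmxA.
  by rewrite (mulmx1C YG') mul1mx.
exists (- (G *m U)); rewrite mulmxN mulNmx mulmxA -GC -!mulmxA -mulmxN.
by rewrite [C *m (U *m C)]mulmxA -CUC YC mulmxA (mulmx1C YG') mul1mx.
Qed.

(** Elimination by rows: the remainder [r] of the top row [d] modulo the lower rows [D'] either
    vanishes or has an invertible entry, which gives a column [g] with [D' *m g = 0] and
    [d *m g = 1%:M] modulo [J]. *)
Lemma regular_mod_field m n (D : 'M[A]_(m, n)) :
  (forall a, J a \/ exists b, J (a * b - 1)) -> regular_mod D.
Proof.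
move=> fieldJ; elim: m D => [|m IHm] D; first by exists 0 => -[].
rewrite -[m.+1]/(1 + m)%N in D *.
rewrite -[D]vsubmxK; set d := usubmx D; set D' := dsubmx D.
have [E DED] := IHm D'.
pose r := d - d *m E *m D'.
have rED : r *m E *m D' === 0.
  by rewrite !mulmxBl -!mulmxA (mulmxA D') DED subrr.
have [r0|/existsNP [j nJr]] := pselect (forall j, J (r ord0 j)).
  exists (row_mx 0 E).
  rewrite -mulmxA mul_row_col mul0mx add0r mul_col_mx !mulmxA.
  have dE : d === d *m E *m D' by move=> i j; rewrite (ord1 i); move: (r0 j); rewrite !mxE.
  move=> i k; rewrite !mxE; case: (split i) => i'; last exact: DED.
  by rewrite -opprB; apply: idealN => //; exact: dE.
have [//|[b rb1]] := fieldJ (r ord0 j).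
pose f : 'cV_n := b *: delta_mx j ord0.
have rf : r *m f === 1%:M.
  move=> i k; rewrite !ord1 -scalemxAr -colE !mxE mulr1n mulrC.
  by move: rb1; rewrite !mxE.
pose g := f - E *m D' *m f.
have rg : r *m g === 1%:M by rewrite mulmxBr !mulmxA rED mul0mx subr0.
have Dg : D' *m g === 0 by rewrite mulmxBr !mulmxA DED subrr.
have dg : d *m g === 1%:M.
  have -> : d = r + d *m E *m D' by rewrite subrK.
  by rewrite mulmxDl -!mulmxA Dg !mulmx0 addr0.
clearbody g; exists (row_mx g (E - g *m d *m E)).
rewrite -mulmxA mul_row_col mulmxBl.
have -> : g *m d + (E *m D' - g *m d *m E *m D') = g *m r + E *m D'.
  by rewrite mulmxBr !mulmxA addrCA addrC.
rewrite mul_col_mx.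
have top : d *m (g *m r + E *m D') === d.
  by rewrite mulmxDr !mulmxA dg mul1mx subrK.
have bot : D' *m (g *m r + E *m D') === D'.
  by rewrite mulmxDr !mulmxA Dg mul0mx add0r.
move=> i k; rewrite [X in J (X - _)]mxE [X in J (_ - X)]mxE.
by case: (split i) => i'; [exact: top | exact: bot].
Qed.

Lemma mxcong_det n (M N : 'M[A]_n) : M === N -> J (\det M - \det N).
Proof.
move=> MN; apply: (big_ind2 (fun a b => J (a - b))).
- by rewrite subrr; exact: ideal0.
- by move=> a b c d ab cd; rewrite opprD addrACA; exact: idealD.
move=> s _; rewrite -mulrBr; apply: ideal_mull => //.
apply: (big_ind2 (fun a b => J (a - b))) => // [|a b c d ab cd].
  by rewrite subrr; exact: ideal0.
have -> : a * c - b * d = (a - b) * c + b * (c - d) by ring.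
by apply: idealD => //; [exact: ideal_mulr | exact: ideal_mull].
Qed.

End MatricesModuloIdeal.

(** * Descent along a regular sequence *)

Section RegularSequences.
Variable A : comNzRingType.
Implicit Types J m : set A.

Lemma mxcong_adjoinP J x p q (M N : 'M[A]_(p, q)) :
  mxcong (adjoin J x) M N <-> exists W, mxcong J M (N + x *: W).
Proof.
split=> [MN|[W MN] i j]; last first.
  exists (M i j - N i j - x * W i j), (W i j); split; last by ring.
  by move: (MN i j); rewrite !mxE opprD addrA.
have /choice [c cP] (k : 'I_p * 'I_q) : exists c,
    J (M k.1 k.2 - N k.1 k.2 - c * x).
  case: k => i j; have [u [c [Ju E]]] := MN i j.
  by exists c; rewrite E addrK.
exists (\matrix_(i, j) c (i, j)) => i j; rewrite !mxE opprD addrA mulrC.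
exact: cP (i, j).
Qed.

(** In [u *m D i.+1 = x *: w], exactness one place lower makes [w] a multiple of [D i.+1]; this is
    why the sequence loses its first matrix. *)
Lemma exact_mod_adjoin J x (r : nat -> nat) (D : forall i, 'M[A]_(r i.+1, r i)) :
  is_ideal J -> (forall a, J (x * a) -> J a) -> exact_mod J D ->
  exact_mod (r := fun i => r i.+1) (adjoin J x) (fun i => D i.+1).
Proof.
move=> iJ regx exD i; split.
  by move=> j k; apply: sub_adjoin; case: (exD i.+1).
move=> k u /mxcong_adjoinP [w]; rewrite add0r => uD.
have /(exact_modP exD) [v wv] : mxcong J (w *m D i) 0.
  move=> j l; rewrite [X in _ - X]mxE subr0; apply: regx.
  have [DD _] := exD i.
  have := mxcong_trans iJ (mxcong_sym iJ (mxcongM iJ uD (mxcong_refl iJ (D i)))).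
  move=> /(_ (u *m 0)); rewrite -mulmxA => /(_ (mxcongM iJ (mxcong_refl iJ u) DD)).
  by move=> /(_ j l); rewrite mulmx0 -scalemxAl [X in _ - X]mxE subr0 [X in J X]mxE.
have [v' uv'] : exists v', mxcong J (u - x *: v) (v' *m D i.+2).
  apply: (exact_modP exD); rewrite mulmxBl -scalemxAl.
  have -> : 0 = x *: w - x *: w by rewrite subrr.
  apply: mxcongD => //; apply: mxcongN => //; apply: mxcongZ => //.
  exact: mxcong_sym.
exists v'; apply/mxcong_adjoinP; exists v.
have {1}-> : u = u - x *: v + x *: v by rewrite subrK.
exact: (mxcongD iJ uv' (mxcong_refl iJ _)).
Qed.

Lemma regular_seq_exact_mod (s : seq A) J (r : nat -> nat)
    (D : forall i, 'M[A]_(r i.+1, r i)) :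
  is_ideal J -> regular_seq J s ->
  (forall x, x \in s -> forall n (V : 'M[A]_n), exists G,
     (1%:M + x *: V) *m G = 1%:M) ->
  (forall p q (M : 'M[A]_(p, q)), regular_mod (adjoin_seq J s) M) ->
  exact_mod J D -> exists i, regular_mod J (D i).
Proof.
elim: s J r D => [|x s IHs] J r D iJ /=; first by exists 0%N.
move=> [regx regs] invs regm exD.
have [||i [E /mxcong_adjoinP [W DED]]] :=
    IHs _ _ _ (adjoin_ideal x iJ) regs _ _ (exact_mod_adjoin iJ regx exD).
- by move=> y ys; apply: invs; rewrite inE ys orbT.
- exact: regm.
(* One shift comes from [exact_mod_adjoin], the other from [exact_mod_regular_inverse]. *)
exists i.+2; apply: exact_mod_regular_inverse DED => //.
by apply: invs; exact: mem_head.
Qed.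

Lemma mxcong1_inv (m : {pred A}) n (Y : 'M[A]_n) :
  noetherian_ring A -> local_ring m -> mxcong [set a | a \in m] Y 1%:M ->
  exists G, Y *m G = 1%:M.
Proof.
move=> noeth locm Y1; have pm := local_ring_prime noeth locm.
have mdet := mxcong_det (prime_is_ideal pm) Y1; rewrite det1 in mdet.
have [|b Eb] := local_ring_unit noeth locm (a := \det Y).
  apply/negP => mD; case: pm => im nm1 _; apply: nm1.
  by rewrite -[1](subKr (\det Y)); exact: (idealB im).
by exists (b *: \adj Y); rewrite -scalemxAr mul_mx_adj scale_scalar_mx mulrC Eb.
Qed.

Lemma regular_local_ring_exact (m : {pred A}) (r : nat -> nat)
    (D : forall i, 'M[A]_(r i.+1, r i)) : regular_local_ring m ->
  (forall i, D i.+1 *m D i = 0) ->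
  (forall i (u : 'rV_(r i.+1)), u *m D i = 0 -> exists v, u = v *m D i.+1) ->
  exists i E, D i *m E *m D i = D i.
Proof.
move=> reg DD exD; have [noeth locm _] := reg.
have [s [sm ms regs]] := regular_local_ring_regular_seq reg.
have pm := local_ring_prime noeth locm; have im := prime_is_ideal pm.
have i0 := zero_ideal A.
have cong0 p q (M N : 'M[A]_(p, q)) : mxcong [set 0] M N <-> M = N.
  split=> [MN|-> i j]; last by rewrite /= subrr.
  by apply/matrixP => i j; apply/eqP; rewrite -subr_eq0; apply/eqP/MN.
have [||| i [E /cong0 DED]] := @regular_seq_exact_mod s [set 0] r D i0 regs.
- move=> x /sm mx n V.
  apply: (mxcong1_inv noeth locm) => i j; rewrite !mxE addrAC subrr add0r.
  exact: ideal_mulr.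
- move=> p q M; apply: regular_mod_field => [|a].
    exact: adjoin_seq_ideal.
  have [ma|nma] := boolP (a \in m); first by left; exact: ms.
  have [b ab1] := local_ring_unit noeth locm nma.
  by right; exists b; rewrite ab1 subrr; exact: (ideal0 (adjoin_seq_ideal s i0)).
- move=> i; split=> [|k u]; first exact/cong0.
  move=> /cong0 uD.
  have /choice [v vP] j : exists v, row j u = v *m D i.+1.
    by apply: exD; rewrite -row_mul uD row0.
  exists (\matrix_j v j); apply/cong0/row_matrixP => j.
  by rewrite row_mul rowK.
by exists i, E.
Qed.

End RegularSequences.

(** * Finite free resolutions *)

Section LinearMaps.
Variable A : comNzRingType.

Definition pair_lin (L M N : lmodType A) (f : L -> M) (g : L -> N) (x : L) :
  M * N := (f x, g x).

Lemma pair_lin_is_linear (L M N : lmodType A)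
  (f : {linear L -> M}) (g : {linear L -> N}) : linear (pair_lin f g).
Proof. by move=> a u v; congr (_, _); rewrite linearP. Qed.

HB.instance Definition _ (L M N : lmodType A)
    (f : {linear L -> M}) (g : {linear L -> N}) :=
  GRing.isLinear.Build A L (M * N)%type _ (pair_lin f g)
    (pair_lin_is_linear f g).

Definition inl_lin (M N : lmodType A) (x : M) : M * N := (x, 0).

Lemma inl_lin_is_linear (M N : lmodType A) : linear (@inl_lin M N).
Proof. by move=> a u v; congr (_, _); rewrite /= scaler0 addr0. Qed.

HB.instance Definition _ (M N : lmodType A) :=
  GRing.isLinear.Build A M (M * N)%type _ (@inl_lin M N)
    (@inl_lin_is_linear M N).

Lemma pair_split (M N : lmodType A) (p : M * N) :
  p = inl_lin N p.1 + inr_lin M p.2.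
Proof. by case: p => x y; congr (_, _); rewrite /= (addr0, add0r). Qed.

Definition rV_lin n (M : lmodType A) (z : 'I_n -> M) (u : 'rV[A]_n) : M :=
  \sum_i u ord0 i *: z i.

Lemma rV_lin_is_linear n (M : lmodType A) (z : 'I_n -> M) : linear (rV_lin z).
Proof.
move=> a u v; rewrite /rV_lin scaler_sumr -big_split /=; apply: eq_bigr => i _.
by rewrite !mxE scalerDl scalerA.
Qed.

HB.instance Definition _ n (M : lmodType A) (z : 'I_n -> M) :=
  GRing.isLinear.Build A 'rV[A]_n M _ (rV_lin z) (rV_lin_is_linear z).

Lemma linear_rVE n (M : lmodType A) (f : {linear 'rV[A]_n -> M}) u :
  f u = rV_lin (fun i => f (delta_mx ord0 i)) u.
Proof.
rewrite {1}[u]row_sum_delta linear_sum; apply: eq_bigr => i _.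
by rewrite linearZ.
Qed.

Lemma rV_lift n (M N : lmodType A) (f : {linear 'rV[A]_n -> N})
    (d : {linear M -> N}) : (forall u, exists y, f u = d y) ->
  exists g : {linear 'rV[A]_n -> M}, forall u, f u = d (g u).
Proof.
move=> fd; have /choice [y yP] i : exists y, f (delta_mx ord0 i) = d y by [].
exists (rV_lin y) => u; rewrite linear_rVE linear_sum; apply: eq_bigr => i _.
by rewrite linearZ /= -yP.
Qed.

Lemma proj_module_rV n : proj_module 'rV[A]_n.
Proof.
split.
  exists n, (delta_mx ord0) => y; exists (y ord0); exact: row_sum_delta.
move=> M N p f surj_p; have [|g gP] := rV_lift (f := f) (d := p); last by exists g.
by move=> u; have [x <-] := surj_p (f u); exists x.
Qed.

Lemma proj_module_prod (M N : lmodType A) :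
  proj_module M -> proj_module N -> proj_module (M * N)%type.
Proof.
move=> [[p [x genx]] projM] [[q [y geny]] projN]; split.
  exists (p + q)%N, (fun i => match split i with
    inl j => inl_lin N (x j) | inr j => inr_lin M (y j) end).
  move=> [u v]; have [[c Ec] [d Ed]] := (genx u, geny v).
  exists (fun i => match split i with inl j => c j | inr j => d j end).
  rewrite big_split_ord /= [LHS]pair_split /= Ec Ed !linear_sum.
  congr (_ + _); apply: eq_bigr => i _.
    by rewrite (unsplitK (inl i)) linearZ.
  by rewrite (unsplitK (inr i)) linearZ.
move=> L K p' f surj_p.
have [g gP] := projM L K p' (f \o @inl_lin M N) surj_p.
have [h hP] := projN L K p' (f \o @inr_lin A M N) surj_p.
exists ((g \o fst) \+ (h \o snd)) => z; rewrite linearD /= gP hP /=.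
by rewrite -linearD -pair_split.
Qed.

End LinearMaps.

(** * Minimal generators and minimal resolutions *)

Section MinimalGenerators.
Variables (A : comNzRingType) (m : {pred A}).
Hypothesis unit_m : forall a, a \notin m -> exists b, a * b = 1.

(** For the least possible [k], a relation with a coefficient outside [m], hence invertible, would
    eliminate a generator. *)
Lemma minimal_generators (M : lmodType A) (P : M -> Prop) n (z : 'I_n -> M) :
  (forall i, P (z i)) ->
  (forall y, P y -> exists c : 'I_n -> A, y = \sum_i c i *: z i) ->
  exists k (y : 'I_k -> M), [/\ forall i, P (y i),
    forall x, P x -> exists c : 'I_k -> A, x = \sum_i c i *: y i &
    forall c : 'I_k -> A, \sum_i c i *: y i = 0 -> forall i, c i \in m].
Proof.
move=> Pz genz.
pose gen k := `[< exists y : 'I_k -> M, (forall i, P (y i)) /\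
  forall x, P x -> exists c : 'I_k -> A, x = \sum_i c i *: y i >].
have ex_gen : exists k, gen k by exists n; apply/asboolP; exists z.
case: (ex_minnP ex_gen) => k /asboolP [y [Py geny]] mink.
exists k, y; split=> // c cy0 i; apply: contrapT => /negP /unit_m [b cb1].
case: k y Py geny mink c cy0 i cb1 => [|k] y Py geny mink c cy0 i cb1.
  by case: i cb1.
suff: gen k by move=> /mink; rewrite ltnn.
have yi : y i = - \sum_j (b * c (lift i j)) *: y (lift i j).
  apply/eqP; rewrite -addr_eq0; apply/eqP.
  rewrite -[RHS](scaler0 _ b) -[in RHS]cy0 (bigD1_ord i) //= scalerDr scaler_sumr.
  rewrite scalerA [b * _]mulrC cb1 scale1r; congr (_ + _).
  by apply: eq_bigr => j _; rewrite scalerA.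
apply/asboolP; exists (fun j => y (lift i j)); split=> // x /geny [d ->].
exists (fun j => d (lift i j) - d i * (b * c (lift i j))).
rewrite (bigD1_ord i) //= {1}yi scalerN scaler_sumr addrC -sumrB.
by apply: eq_bigr => j _; rewrite scalerBl scalerA.
Qed.

End MinimalGenerators.

Section LocalRing.
Variables (A : comNzRingType) (m : {pred A}).
Hypotheses (noeth : noetherian_ring A) (locm : local_ring m).

Let pm : is_prime [set a | a \in m] := local_ring_prime noeth locm.
Let im := prime_is_ideal pm.
Let unit_m := local_ring_unit noeth locm.

(** A minimal cover splits; the resulting idempotent [E] is congruent to [1] modulo [m] by
    minimality, hence invertible, hence equal to [1]. *)
Lemma proj_module_free (P : lmodType A) : proj_module P ->
  exists n (f : {linear 'rV[A]_n -> P}) (g : {linear P -> 'rV[A]_n}),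
    cancel f g /\ cancel g f.
Proof.
move=> [[n0 [z genz]] projP].
have [n [y [_ geny miny]]] :=
  @minimal_generators A m unit_m P (fun=> True) n0 z (fun=> I) (fun y _ => genz y).
have [|g gK] := projP _ _ (rV_lin y) idfun.
  move=> x; have [c Ec] := geny x I; exists (\row_i c i); rewrite Ec.
  by apply: eq_bigr => i _; rewrite mxE.
exists n, (rV_lin y), g; split=> // u.
pose E := lin1_mx (g \o rV_lin y).
have EE : E *m E = E.
  by apply/row_matrixP => i; rewrite row_mul !rowE !mul_rV_lin1 /= gK.
have [|G EG] := @mxcong1_inv A m n E noeth locm.
  move=> i j; rewrite /= -opprB; apply: (idealN im).
  have : rV_lin y (row i (1%:M - E)) = 0.
    rewrite rowE mulmxBr mulmx1 mul_rV_lin1 linearB /= gK subrr //.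
  by move=> /miny /(_ j); rewrite !mxE.
have E1 : E = 1%:M by rewrite -EG -[in RHS]EE -mulmxA EG mulmx1.
by rewrite -[RHS]mulmx1 -E1 mul_rV_lin1.
Qed.

(* [finite_res k K]: the submodule [K] of the free module has a free resolution
   of length [< k]. *)
Fixpoint finite_res k n (K : 'rV[A]_n -> Prop) : Prop :=
  if k is k'.+1 then
    exists p (D : 'M[A]_(p, n)), (forall u, K u <-> exists v, u = v *m D) /\
      finite_res k' (fun v => v *m D = 0)
  else forall u, K u -> u = 0.

Lemma finite_resS k n (K : 'rV[A]_n -> Prop) :
  K 0 -> finite_res k K -> finite_res k.+1 K.
Proof.
elim: k n K => [|k IHk] n K K0 /=.
  move=> K1; exists 0%N, 0; split=> [u|u _]; last by apply/rowP => -[].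
  by split=> [/K1 ->|[v ->]]; [exists 0 |]; rewrite mulmx0.
by move=> [p [D [KD resD]]]; exists p, D; split=> //; apply: IHk; rewrite ?mul0mx.
Qed.

Lemma finite_res_leq k l n (K : 'rV[A]_n -> Prop) :
  K 0 -> (k <= l)%N -> finite_res k K -> finite_res l K.
Proof.
move=> K0 /subnK <-; elim: (l - k)%N => [//|i IHi] /IHi.
by rewrite addSn; exact: finite_resS.
Qed.

End LocalRing.

(** In the minimal resolution let [C *m E *m C = C]. The rows of [1%:M - C *m E] are syzygies, so it
    has entries in [m], as has [C *m E]; then [1] lies in [m] unless the term has rank zero. *)
Lemma regular_local_ring_finite_res (A : comNzRingType) (m : {pred A}) n
    (K : 'rV[A]_n -> Prop) : regular_local_ring m ->
  K 0 -> (forall a u v, K u -> K v -> K (a *: u + v)) -> exists k, finite_res k K.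
Proof.
move=> reg K0 KP; have [noeth locm _] := reg.
have pm := local_ring_prime noeth locm; have im := prime_is_ideal pm.
have syz p (P : 'rV[A]_p -> Prop) : P 0 ->
    (forall a u v, P u -> P v -> P (a *: u + v)) ->
    exists t : {q & 'M[A]_(q, p)},
      (forall u, P u <-> exists v, u = v *m projT2 t) /\
      (forall u : 'rV_(projT1 t), u *m projT2 t = 0 -> forall i, u ord0 i \in m).
  move=> P0 PP.
  have [q0 [z0 [Pz0 genz0]]] := fg_submodule_span noeth P0 PP
    (fun u _ => ex_intro _ (u ord0) (row_sum_delta u)).
  have [q [z [Pz genz minz]]] :=
    minimal_generators (local_ring_unit noeth locm) Pz0 genz0.
  pose Z : 'M[A]_(q, p) := \matrix_i z i.
  have ZE (u : 'rV_q) : u *m Z = \sum_i u ord0 i *: z i.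
    by rewrite mulmx_sum_row; apply: eq_bigr => i _; rewrite rowK.
  exists (existT _ q Z); split=> u; last first.
    by move=> uZ; apply: minz; rewrite -ZE.
  split=> [/genz [c ->]|[v ->]].
    by exists (\row_i c i); rewrite [RHS]ZE; apply: eq_bigr => i _; rewrite mxE.
  rewrite [_ *m _]ZE; elim/big_ind: _ => // [x y Px Py|i _].
    by rewrite -[x]scale1r; exact: PP.
  by rewrite -[_ *: _]addr0; exact: PP.
have kerP p q (D : 'M[A]_(q, p)) a (u v : 'rV_q) :
    u *m D = 0 -> v *m D = 0 -> (a *: u + v) *m D = 0.
  by move=> uD vD; rewrite mulmxDl -scalemxAl uD vD scaler0 addr0.
pose S := {p & {q & 'M[A]_(q, p)}}.
have next (t : S) := cid (syz _ (fun v => v *m projT2 (projT2 t) = 0)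
  (mul0mx _ _) (@kerP _ _ _)).
have [t0 [t0K t0min]] := syz _ _ K0 KP.
pose st i : S := iter i (fun t => existT _ _ (sval (next t))) (existT _ n t0).
pose r i := projT1 (st i).
pose D i : 'M[A]_(r i.+1, r i) := projT2 (projT2 (st i)).
have exD i (u : 'rV_(r i.+1)) : u *m D i = 0 <-> exists v, u = v *m D i.+1.
  exact: (proj1 (svalP (next (st i))) u).
have minD i (u : 'rV_(r i.+1)) : u *m D i = 0 -> forall j, u ord0 j \in m.
  by case: i u => [|i] u; [exact: t0min | exact: (proj2 (svalP (next (st i))) u)].
have DD i : D i.+1 *m D i = 0.
  apply/row_matrixP => j; rewrite row_mul row0; apply/exD.
  by exists (delta_mx ord0 j); rewrite rowE.
(* The shift matters: the rows of [D i.+1] are syzygies and have entries in [m], while those of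
   [D 0] are only generators of [K]. *)
have [||i [E DED]] := @regular_local_ring_exact A m (fun i => r i.+1)
    (fun i => D i.+1) reg.
- by move=> i; exact: DD.
- by move=> i u /exD.
have r0 : r i.+2 = 0%N.
  case Er : (r i.+2) => [//|q].
  have j : 'I_(r i.+2) by rewrite Er; exact: ord0.
  case: pm => _ nm1 _; case: nm1.
  pose C := D i.+1.
  have -> : 1 = (1%:M - C *m E) j j + (C *m E) j j.
    by rewrite !mxE eqxx subrK.
  apply: (idealD im).
    suff : row j (1%:M - C *m E) ord0 j \in m by rewrite mxE.
    by apply: minD; rewrite -row_mul mulmxBl mul1mx DED subrr row0.
  rewrite mxE; apply: (ideal_sum im) => l; apply: (ideal_mulr _ im) => /=.
  suff : row j C ord0 l \in m by rewrite mxE.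
  by apply: minD; rewrite -row_mul DD row0.
have res k j : (j + k)%N = i.+1 -> finite_res k (fun v => v *m D j = 0).
  elim: k j => [|k IHk] j Ej.
    rewrite addn0 in Ej; subst j => u _; apply/rowP => -[l ltl].
    by have := ltl; rewrite [X in (_ < X)%N -> _]r0.
  exists (r j.+2), (D j.+1); split; first exact: exD.
  by apply: IHk; rewrite addSnnS.
exists i.+2; exists (r 1%N), (D 0%N); split; first exact: t0K.
exact: res.
Qed.

(** * K-projective resolutions of 2-periodic complexes *)

Section Complexes.
Variable A : comNzRingType.
Implicit Types X Y P C : cpx2 A.

(** With this form [homotopic2 f g] is convertible to [null2 (sub_map2 f g)]. *)
Definition null2 X Y (f : map2 X Y) :=
  exists (s0 : {linear ev X -> od Y}) (s1 : {linear od X -> ev Y}),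
    (forall x, m0 f x = d1 Y (s0 x) + s1 (d0 X x)) /\
    (forall x, m1 f x = d0 Y (s1 x) + s0 (d1 X x)).

Definition K_projective P := forall C (h : map2 P C), acyclic2 C -> null2 h.

Program Definition sub_map2 X Y (f g : map2 X Y) : map2 X Y :=
  @Map2 A X Y (m0 f \- m0 g) (m1 f \- m1 g) _ _.
Next Obligation. by rewrite /= !m1_d0 linearB. Qed.
Next Obligation. by rewrite /= !m0_d1 linearB. Qed.

Lemma acyclic2_shift C : acyclic2 C -> acyclic2 (shift2 C).
Proof.
move=> [ex0 ex1]; split=> y /= /eqP; rewrite oppr_eq0 => /eqP.
  by move=> /ex1 [w ->]; exists (- w); rewrite /= linearN opprK.
by move=> /ex0 [w ->]; exists (- w); rewrite /= linearN opprK.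
Qed.

(** The composite from [P] to [cone2 s] is null-homotopic; up to sign, the [X]-component of the
    homotopy is the lift and its [Y]-component the required homotopy. *)
Lemma K_projective_lift P X Y (s : map2 X Y) (f : map2 P Y) :
  K_projective P -> acyclic2 (cone2 s) ->
  exists g : map2 P X, homotopic2 (comp2 s g) f.
Proof.
move=> projP acs.
have [t0 [t1 [E0 E1]]] := projP _ (comp2 (cone2_in s) f) acs.
have {}E0 x := E0 x; have {}E1 x := E1 x.
have g10 x : (\- (fst \o t1)) (d0 P x) = d0 X ((\- (fst \o t0)) x).
  have /(congr1 fst) /= := E0 x; rewrite linearN => /eqP.
  by rewrite eq_sym addrC addr_eq0 opprK => /eqP ->.
have g01 x : (\- (fst \o t0)) (d1 P x) = d1 X ((\- (fst \o t1)) x).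
  have /(congr1 fst) /= := E1 x; rewrite linearN => /eqP.
  by rewrite eq_sym addrC addr_eq0 opprK => /eqP ->.
exists (@Map2 _ P X (\- (fst \o t0)) (\- (fst \o t1)) g10 g01).
exists (\- (snd \o t0)), (\- (snd \o t1)); split=> x /=.
  have /(congr1 snd) /= -> := E0 x; rewrite !linearN /= !opprD opprK.
  by rewrite [X in _ + (X - _)]addrC -addrA addKr.
have /(congr1 snd) /= -> := E1 x; rewrite !linearN /= !opprD opprK.
by rewrite [X in _ + (X - _)]addrC -addrA addKr.
Qed.

Lemma K_projective_inj P X Y (s : map2 X Y) (f : map2 P X) :
  K_projective P -> acyclic2 (cone2 s) -> null2 (comp2 s f) -> null2 f.
Proof.
move=> projP acs [t0 [t1 [E0 E1]]].
(* By periodicity this is also the cone shifted by [-1]; [f] paired with the null-homotopy of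
   [comp2 s f] is a chain map into it. *)
pose C := shift2 (cone2 s).
pose k0 : {linear ev P -> ev C} := pair_lin (m0 f) t0.
pose k1 : {linear od P -> od C} := pair_lin (m1 f) t1.
have k10 x : k1 (d0 P x) = d0 C (k0 x).
  apply: injective_projections => /=; first by rewrite opprK m1_d0.
  by have /= -> := E0 x; rewrite opprB addrAC subrr add0r.
have k01 x : k0 (d1 P x) = d1 C (k1 x).
  apply: injective_projections => /=; first by rewrite opprK m0_d1.
  by have /= -> := E1 x; rewrite opprB addrAC subrr add0r.
have [u0 [u1 [F0 F1]]] := projP C (Map2 k10 k01) (acyclic2_shift acs).
exists (fst \o u0), (fst \o u1); split=> x /=.
  by have /(congr1 fst) /= -> := F0 x; rewrite opprK.
by have /(congr1 fst) /= -> := F1 x; rewrite opprK.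
Qed.

Definition zero_cpx : cpx2 A :=
  @Cpx2 A 'rV[A]_0 'rV[A]_0 \0 \0 (fun _ => erefl) (fun _ => erefl).

Lemma zero_rV0 (u : 'rV[A]_0) : u = 0. Proof. by apply/rowP => -[]. Qed.

Lemma K_projective_zero : K_projective zero_cpx.
Proof.
move=> C h _; exists \0, \0; split=> x /=.
  by rewrite (zero_rV0 x) !linear0 addr0.
by rewrite (zero_rV0 x) !linear0 addr0.
Qed.

Lemma zero_cpx_resolution X : acyclic2 X ->
  exists h : map2 zero_cpx X, acyclic2 (cone2 h).
Proof.
move=> [ex0 ex1].
pose h0 : {linear ev zero_cpx -> ev X} := \0.
pose h1 : {linear od zero_cpx -> od X} := \0.
have h10 x : h1 (d0 zero_cpx x) = d0 X (h0 x) by rewrite /= linear0.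
have h01 x : h0 (d1 zero_cpx x) = d1 X (h1 x) by rewrite /= linear0.
exists (Map2 h10 h01); split=> -[u y] [_ dy].
  have [|w ->] := ex0 y; first by rewrite -[LHS]subr0.
  by exists (0, w); congr (_, _); rewrite ?subr0 // [LHS]zero_rV0 [RHS]zero_rV0.
have [|w ->] := ex1 y; first by rewrite -[LHS]subr0.
by exists (0, w); congr (_, _); rewrite ?subr0 // [LHS]zero_rV0 [RHS]zero_rV0.
Qed.

(** * Resolving by iterated cones of free covers *)

Section Extension.
Variables (p q : nat) (X : cpx2 A).
Variables (f0 : {linear 'rV[A]_p -> ev X}) (f1 : {linear 'rV[A]_q -> od X}).
Hypotheses (d0f0 : forall u, d0 X (f0 u) = 0) (d1f1 : forall u, d1 X (f1 u) = 0).

Definition free_cpx : cpx2 A :=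
  @Cpx2 A 'rV[A]_p 'rV[A]_q \0 \0 (fun _ => erefl) (fun _ => erefl).

Lemma free_map_m1 (u : ev free_cpx) : f1 (d0 free_cpx u) = d0 X (f0 u).
Proof. by rewrite d0f0 linear0. Qed.

Lemma free_map_m0 (u : od free_cpx) : f0 (d1 free_cpx u) = d1 X (f1 u).
Proof. by rewrite d1f1 linear0. Qed.

Definition free_map : map2 free_cpx X := Map2 free_map_m1 free_map_m0.

(* A resolution [P] of the cone of [F -> X] yields the resolution of [X] by the
   extension of [P] by [F] with the differential [(c, x) |-> (a x, d x)], where
   [a] is the component in [F] of the map from [P] to the cone. *)
Lemma extend_resolution P (g : map2 P (cone2 free_map)) :
  proj_module (ev P) -> proj_module (od P) -> K_projective P ->
  acyclic2 (cone2 g) ->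
  exists Q (h : map2 Q X), [/\ proj_module (ev Q), proj_module (od Q),
    K_projective Q & acyclic2 (cone2 h)].
Proof.
move=> proj0 proj1 projP [ex0 ex1].
have [a0 a0E] : exists a : {linear ev P -> 'rV[A]_q}, forall x, (m0 g x).1 = a x.
  by exists (fst \o m0 g).
have [b0 b0E] : exists b : {linear ev P -> ev X}, forall x, (m0 g x).2 = b x.
  by exists (snd \o m0 g).
have [a1 a1E] : exists a : {linear od P -> 'rV[A]_p}, forall x, (m1 g x).1 = a x.
  by exists (fst \o m1 g).
have [b1 b1E] : exists b : {linear od P -> od X}, forall x, (m1 g x).2 = b x.
  by exists (snd \o m1 g).
have a1d0 x : a1 (d0 P x) = 0 by rewrite -a1E m1_d0 /= oppr0.
have a0d1 x : a0 (d1 P x) = 0 by rewrite -a0E m0_d1 /= oppr0.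
have b1d0 x : b1 (d0 P x) = d0 X (b0 x) - f1 (a0 x).
  by rewrite -b1E m1_d0 -b0E -a0E.
have b0d1 x : b0 (d1 P x) = d1 X (b1 x) - f0 (a1 x).
  by rewrite -b0E m0_d1 -b1E -a1E.
pose e0 : {linear ('rV[A]_p * ev P)%type -> ('rV[A]_q * od P)%type} :=
  pair_lin (a0 \o snd) (d0 P \o snd).
pose e1 : {linear ('rV[A]_q * od P)%type -> ('rV[A]_p * ev P)%type} :=
  pair_lin (a1 \o snd) (d1 P \o snd).
have e1e0 x : e1 (e0 x) = 0 by rewrite /= /pair_lin /= a1d0 d1d0.
have e0e1 x : e0 (e1 x) = 0 by rewrite /= /pair_lin /= a0d1 d0d1.
pose Q := Cpx2 e1e0 e0e1.
pose h0 : {linear ev Q -> ev X} := (f0 \o fst) \+ (b0 \o snd).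
pose h1 : {linear od Q -> od X} := (f1 \o fst) \+ (b1 \o snd).
have h10 x : h1 (d0 Q x) = d0 X (h0 x).
  by rewrite /h1 /h0 /= b1d0 linearD d0f0 add0r addrC subrK.
have h01 x : h0 (d1 Q x) = d1 X (h1 x).
  by rewrite /h1 /h0 /= b0d1 linearD d1f1 add0r addrC subrK.
exists Q, (Map2 h10 h01); split.
- exact: proj_module_prod (proj_module_rV _ _) proj0.
- exact: proj_module_prod (proj_module_rV _ _) proj1.
- move=> C k [exC0 exC1].
  have kd0 z : d0 C (m0 k z) = m1 k (e0 z) := esym (m1_d0 k z).
  have kd1 z : d1 C (m1 k z) = m0 k (e1 z) := esym (m0_d1 k z).
  (* On the free summand [k] takes values in cocycles of [C], hence in boundaries, and these lift
     linearly. *)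
  have [u|s0 s0P] := @rV_lift A p _ _ (m0 k \o @inl_lin A _ _) (d1 C).
    apply: exC0; apply: etrans (kd0 _) _.
    have -> : e0 (inl_lin (ev P) u) = 0 by rewrite /= /pair_lin /= !linear0.
    exact: linear0.
  have [u|s1 s1P] := @rV_lift A q _ _ (m1 k \o @inl_lin A _ _) (d0 C).
    apply: exC1; apply: etrans (kd1 _) _.
    have -> : e1 (inl_lin (od P) u) = 0 by rewrite /= /pair_lin /= !linear0.
    exact: linear0.
  (* Removing the contraction on the free summand leaves a chain map on [P]. *)
  pose k0 : {linear ev P -> ev C} := (m0 k \o @inr_lin A _ _) \- (s1 \o a0).
  pose k1 : {linear od P -> od C} := (m1 k \o @inr_lin A _ _) \- (s0 \o a1).
  have kE0 z : m0 k z = d1 C (s0 z.1) + (k0 z.2 + s1 (a0 z.2)).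
    by rewrite subrK -s0P -[LHS](congr1 (m0 k) (esym (pair_split z))) linearD.
  have kE1 z : m1 k z = d0 C (s1 z.1) + (k1 z.2 + s0 (a1 z.2)).
    by rewrite subrK -s1P -[LHS](congr1 (m1 k) (esym (pair_split z))) linearD.
  have k10 x : k1 (d0 P x) = d0 C (k0 x).
    have /eqP := kd0 (0, x); rewrite kE0 kE1 /= a1d0 !linear0 add0r addr0 linearD.
    by rewrite [X in _ == X]addrC => /eqP/addIr.
  have k01 x : k0 (d1 P x) = d1 C (k1 x).
    have /eqP := kd1 (0, x); rewrite kE0 kE1 /= a0d1 !linear0 add0r addr0 linearD.
    by rewrite [X in _ == X]addrC => /eqP/addIr.
  have [t0 [t1 [T0 T1]]] := projP C (Map2 k10 k01) (conj exC0 exC1).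
  exists ((s0 \o fst) \+ (t0 \o snd)), ((s1 \o fst) \+ (t1 \o snd)).
  split=> z; rewrite ?kE0 ?kE1 /=.
    by have /= -> := T0 z.2; rewrite linearD -!addrA; congr (_ + (_ + _)); exact: addrC.
  by have /= -> := T1 z.2; rewrite linearD -!addrA; congr (_ + (_ + _)); exact: addrC.
(* Regrouping [((c, x), y)] as [(x, (c, y))] identifies the cone of [h] with that of [g]. *)
split=> -[[c x] y] /= [/= Ec Ex Ey].
  have [|[x' [c' y']] /= [-> Ec' Ey']] := ex0 (x, (c, y)).
    apply: injective_projections => //=; apply: injective_projections => /=.
      by rewrite a1E oppr0 add0r.
    by rewrite b1E -addrA -opprD.
  exists ((c', x'), y'); rewrite Ec' Ey' a0E b0E oppr0 add0r.
  by congr ((_, _), _); rewrite /= opprD addrA.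
have [|[x' [c' y']] /= [-> Ec' Ey']] := ex1 (x, (c, y)).
  apply: injective_projections => //=; apply: injective_projections => /=.
    by rewrite a0E oppr0 add0r.
  by rewrite b0E -addrA -opprD.
exists ((c', x'), y'); rewrite Ec' Ey' a1E b1E oppr0 add0r.
by congr ((_, _), _); rewrite /= opprD addrA.
Qed.

End Extension.

Section Covers.
Variables (L M N : lmodType A) (a : {linear L -> M}) (b : {linear M -> N}).

Definition cohomology_cover p (f : 'rV[A]_p -> M) :=
  (forall u, b (f u) = 0) /\ forall y, b y = 0 -> exists u w, y = f u + a w.

Definition cover_kernel p (f : 'rV[A]_p -> M) (u : 'rV[A]_p) :=
  exists w, f u = a w.

Lemma fg_cohomology_cover : fg_cohomology a b ->
  exists p (f : {linear 'rV[A]_p -> M}), cohomology_cover f.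
Proof.
move=> [p [z [bz genz]]]; exists p, (rV_lin z); split=> [u|y /genz [c [w ->]]].
  by rewrite linear_sum big1 // => i _; rewrite linearZ /= bz scaler0.
exists (\row_i c i), w; congr (_ + _); apply: eq_bigr => i _.
by rewrite mxE.
Qed.

(* The cohomology of the cone of a cover is the kernel of the cover, which is
   here the row space of [D]; the cover of it by the rows of [D] has kernel
   [ker D]. *)
Lemma cone_cover p q (f : {linear 'rV[A]_p -> M}) (g : {linear 'rV[A]_q -> N})
    n (D : 'M[A]_(n, q)) :
  (forall w, b (a w) = 0) -> cohomology_cover f ->
  (forall u, (exists y, g u = b y) <-> exists v, u = v *m D) ->
  let a' := cone_d (\0 : {linear 'rV[A]_p -> 'rV[A]_q}) a f in
  exists h : {linear 'rV[A]_n -> ('rV[A]_q * M)%type},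
    [/\ forall u, cone_d (\0 : {linear 'rV[A]_q -> 'rV[A]_p}) b g (h u) = 0,
       forall y, cone_d (\0 : {linear 'rV[A]_q -> 'rV[A]_p}) b g y = 0 ->
         exists u w, y = h u + a' w &
       forall u, (exists w, h u = a' w) <-> u *m D = 0].
Proof.
move=> ba0 [bf0 coverf] KD a'.
have [u|h hP] := @rV_lift A n _ _ (g \o mulmxr D) b.
  by apply/KD; exists u.
exists (pair_lin (mulmxr D) h); split=> [u|[v y] /= [_ Ey]|u].
- apply: injective_projections; rewrite /= ?oppr0 //.
  by rewrite -hP /= subrr.
- have /KD [u Ev] : exists y, g v = b y.
    by exists y; apply/esym/eqP; rewrite -subr_eq0 Ey.
  have [|c [w E]] := coverf (y - h u).
    by rewrite linearB -hP /= -Ev Ey.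
  exists u, (- c, w); apply: injective_projections => /=.
    by rewrite oppr0 addr0.
  by rewrite linearN opprK [_ + f c]addrC -E addrC subrK.
split=> [[[c w]] [-> _]|uD]; first by rewrite oppr0.
have [|c [w E]] := coverf (h u); first by rewrite -hP /= uD linear0.
exists (- c, w); apply: injective_projections => /=; first by rewrite uD oppr0.
by rewrite linearN opprK addrC.
Qed.

End Covers.

(** Passing to the cone shortens the resolutions of both kernels by one step; at [k = 0] the covers
    are bijective on cohomology and their cone is acyclic. *)
Lemma resolution_of_cover k X p q
    (f0 : {linear 'rV[A]_p -> ev X}) (f1 : {linear 'rV[A]_q -> od X}) :
  cohomology_cover (d1 X) (d0 X) f0 -> cohomology_cover (d0 X) (d1 X) f1 ->
  finite_res k (cover_kernel (d1 X) f0) -> finite_res k (cover_kernel (d0 X) f1) ->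
  exists P (h : map2 P X), [/\ proj_module (ev P), proj_module (od P),
    K_projective P & acyclic2 (cone2 h)].
Proof.
elim: k X p q f0 f1 => [|k IHk] X p q f0 f1 cov0 cov1.
  move=> /= ker0 ker1; have [[df0 gen0] [df1 gen1]] := (cov0, cov1).
  have acf : acyclic2 (cone2 (free_map df0 df1)).
    split=> -[u y] /= [_ Ey].
      have u0 : u = 0.
        by apply: ker1; exists y; apply/esym/eqP; rewrite -subr_eq0 Ey.
      have [|c [w ->]] := gen0 y; first by move: Ey; rewrite u0 linear0 subr0.
      exists (- c, w); apply: injective_projections => /=; first by rewrite u0 oppr0.
      by rewrite linearN opprK addrC.
    have u0 : u = 0.
      by apply: ker0; exists y; apply/esym/eqP; rewrite -subr_eq0 Ey.
    have [|c [w ->]] := gen1 y; first by move: Ey; rewrite u0 linear0 subr0.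
    exists (- c, w); apply: injective_projections => /=; first by rewrite u0 oppr0.
    by rewrite linearN opprK addrC.
  have [g acg] := zero_cpx_resolution acf.
  apply: extend_resolution acg; try exact: proj_module_rV.
  exact: K_projective_zero.
move=> [n0 [D0 [KD0 res0]]] [n1 [D1 [KD1 res1]]].
(* Parity switches: the even cohomology of the cone is the kernel of the odd cover. *)
have [h0 [dh0 cov_h0 ker_h0]] := cone_cover (@d0d1 A X) cov0 KD1.
have [h1 [dh1 cov_h1 ker_h1]] := cone_cover (@d1d0 A X) cov1 KD0.
have [[df0 _] [df1 _]] := (cov0, cov1).
have [||||P [g [proj0 proj1 projP acg]]] :=
  IHk (cone2 (free_map df0 df1)) _ _ h0 h1.
- by split; [exact: dh0 | exact: cov_h0].
- by split; [exact: dh1 | exact: cov_h1].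
- rewrite (_ : cover_kernel _ _ = fun u => u *m D1 = 0) //.
  by apply/funext => u; apply/propext; exact: ker_h0.
- rewrite (_ : cover_kernel _ _ = fun u => u *m D0 = 0) //.
  by apply/funext => u; apply/propext; exact: ker_h1.
exact: extend_resolution acg.
Qed.

(** * Resolutions and contractions over a regular local ring *)

Section RegularLocal.
Variable m : {pred A}.
Hypothesis reg : regular_local_ring m.

Lemma ex_resolution X : fg_cpx2 X ->
  exists P (h : map2 P X), [/\ proj_module (ev P), proj_module (od P),
    K_projective P & acyclic2 (cone2 h)].
Proof.
move=> [/fg_cohomology_cover [p [f0 cov0]] /fg_cohomology_cover [q [f1 cov1]]].
have ker0 (L M : lmodType A) (a : {linear L -> M}) n (f : {linear 'rV[A]_n -> M}) :
    cover_kernel a f 0.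
  by exists 0; rewrite !linear0.
have kerP (L M : lmodType A) (a : {linear L -> M}) n (f : {linear 'rV[A]_n -> M}) c u v :
    cover_kernel a f u -> cover_kernel a f v -> cover_kernel a f (c *: u + v).
  by move=> [y Ey] [z Ez]; exists (c *: y + z); rewrite !linearP Ey Ez.
have [k0 res0] := regular_local_ring_finite_res reg (ker0 _ _ (d1 X) _ f0)
  (kerP _ _ (d1 X) _ f0).
have [k1 res1] := regular_local_ring_finite_res reg (ker0 _ _ (d0 X) _ f1)
  (kerP _ _ (d0 X) _ f1).
apply: (resolution_of_cover (k := maxn k0 k1) cov0 cov1).
  by apply: finite_res_leq res0; [exact: ker0 | exact: leq_maxl].
by apply: finite_res_leq res1; [exact: ker0 | exact: leq_maxr].
Qed.

(* The defect [y - (a e + t b) y] of the homotopy [(t, e)] squares to zero;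
   hence the correction [e + e (1 - a e - t b)]. *)
Lemma contraction_of_regular (M N : lmodType A) (a : {linear M -> N})
    (b : {linear N -> M}) (e : {linear N -> M})
    p (f : {linear 'rV[A]_p -> M}) (g : {linear M -> 'rV[A]_p}) :
  (forall y, a (b y) = 0) -> (forall x, b (a x) = 0) ->
  exact_at a b -> exact_at b a -> cancel g f -> (forall x, a (e (a x)) = a x) ->
  exists (s0 : {linear M -> N}) (s1 : {linear N -> M}),
    (forall x, x = b (s0 x) + s1 (a x)) /\ (forall y, y = a (s1 y) + s0 (b y)).
Proof.
move=> ab0 ba0 exb exa gK aea.
(* The values of [1 - e a] lie in the kernel of [a], which is the image of [b]; they lift on the
   free module and are brought back along [g]. *)
have [u|t' t'P] := rV_lift (f := (idfun \- (e \o a)) \o f) (d := b).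
  by apply: exa; rewrite /= linearB aea subrr.
have [t bt] : exists t : {linear M -> N}, forall x, b (t x) = x - e (a x).
  by exists (t' \o g) => x; rewrite /= -t'P /= gK.
have [phi phiE] : exists phi : {linear N -> N},
    forall y, phi y = y - a (e y) - t (b y).
  by exists (idfun \- (a \o e) \- (t \o b)).
have bphi y : b (phi y) = 0.
  by rewrite phiE !linearB /= ba0 subr0 bt ab0 linear0 subr0 subrr.
have phia x : phi (a x) = 0 by rewrite phiE aea subrr sub0r ba0 linear0 oppr0.
have aephi y : a (e (phi y)) = phi y by have [w ->] := exb _ (bphi y).
exists t, (e \+ (e \o phi)); split=> [x|y] /=.
  by rewrite bt phia linear0 addr0 subrK.
by rewrite linearD aephi phiE -addrA subrK addrC subrK.
Qed.

(* By [regular_local_ring_exact], one of the two matrices of the complex, seen as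
   a periodic exact sequence, has a generalized inverse. *)
Lemma acyclic_proj_contractible C : proj_module (ev C) -> proj_module (od C) ->
  acyclic2 C -> null2 (id2 C).
Proof.
move=> proj0 proj1 [ex0 ex1]; have [noeth locm _] := reg.
have [p [f [g [fK gK]]]] := proj_module_free noeth locm proj0.
have [q [f' [g' [f'K g'K]]]] := proj_module_free noeth locm proj1.
pose B := lin1_mx (g' \o (d0 C \o f)); pose B' := lin1_mx (g \o (d1 C \o f')).
have BE u : u *m B = g' (d0 C (f u)) by rewrite mul_rV_lin1.
have BE' u : u *m B' = g (d1 C (f' u)) by rewrite mul_rV_lin1.
(* Indexing by parity makes [D (odd i)] an infinite sequence, since [odd i.+1] computes to
   [~~ odd i]. *)
pose r b := if b then q else p.
pose D b : 'M[A]_(r (~~ b), r b) :=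
  if b return 'M[A]_(r (~~ b), r b) then B else B'.
have DD b : D (~~ b) *m D b = 0.
  apply/row_matrixP => i; rewrite row_mul row0.
  by case: b i => i /=; rewrite rowE ?BE' ?BE ?f'K ?g'K ?gK ?d1d0 ?d0d1 linear0.
have exD b (u : 'rV_(r (~~ b))) : u *m D b = 0 -> exists v, u = v *m D (~~ b).
  case: b u => u /=; rewrite ?BE ?BE' => u0.
    have [|w Ew] := ex0 (f u); first by rewrite -[LHS]g'K u0 linear0.
    by exists (g' w); rewrite BE' g'K -Ew fK.
  have [|w Ew] := ex1 (f' u); first by rewrite -[LHS]gK u0 linear0.
  by exists (g w); rewrite BE gK -Ew f'K.
have [b [E DED]] : exists b (E : 'M_(r b, r (~~ b))), D b *m E *m D b = D b.
  have [i [E DED]] := @regular_local_ring_exact A m (fun i => r (odd i))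
    (fun i => D (odd i)) reg (fun i => DD (odd i)) (fun i => @exD (odd i)).
  by exists (odd i), E.
case: b E DED => /= E DED.
  have [|s0 [s1 [S0 S1]]] := @contraction_of_regular _ _ (d0 C) (d1 C)
    (f \o (mulmxr E \o g')) p f g (@d0d1 _ C) (@d1d0 _ C) ex1 ex0 gK.
    move=> x /=; rewrite -{1}[x]gK -BE -[LHS]g'K -BE -2!mulmxA (mulmxA B) DED BE gK g'K //.
  by exists s0, s1.
have [|s1 [s0 [S1 S0]]] := @contraction_of_regular _ _ (d1 C) (d0 C)
  (f' \o (mulmxr E \o g)) q f' g' (@d1d0 _ C) (@d0d1 _ C) ex0 ex1 g'K.
  move=> x /=; rewrite -{1}[x]g'K -BE' -[LHS]gK -BE' -2!mulmxA (mulmxA B') DED BE' g'K gK //.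
by exists s0, s1.
Qed.

(** A null-homotopy of [comp2 h q] extends [h] over the cone of [q]; composed with a contraction of
    the cone, the extension contracts [h]. *)
Lemma K_projective_cone P X (q : map2 P X) :
  K_projective P -> null2 (id2 (cone2 q)) -> K_projective X.
Proof.
move=> projP [s0 [s1 [S0 S1]]] C h acC.
have [t0 [t1 [T0 T1]]] := projP C (comp2 h q) acC.
pose k0 : {linear ev (cone2 q) -> ev C} := (m0 h \o snd) \- (t1 \o fst).
pose k1 : {linear od (cone2 q) -> od C} := (m1 h \o snd) \- (t0 \o fst).
have k10 z : k1 (d0 (cone2 q) z) = d0 C (k0 z).
  rewrite /k1 /k0 /= !linearB !linearN /= m1_d0 opprK.
  by have /= -> := T1 z.1; rewrite opprD addrA subrK.
have k01 z : k0 (d1 (cone2 q) z) = d1 C (k1 z).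
  rewrite /k1 /k0 /= !linearB !linearN /= m0_d1 opprK.
  by have /= -> := T0 z.1; rewrite opprD addrA subrK.
exists (k1 \o (s0 \o @inr_lin A _ _)), (k0 \o (s1 \o @inr_lin A _ _)).
split=> x.
  have -> : m0 h x = k0 (inr_lin (od P) x) by rewrite /k0 /= linear0 subr0.
  rewrite [inr_lin _ _]S0 linearD k01; congr (_ + k0 (s1 _)).
  by apply: injective_projections => /=; rewrite linear0 ?subr0 ?oppr0.
have -> : m1 h x = k1 (inr_lin (ev P) x) by rewrite /k1 /= linear0 subr0.
rewrite [inr_lin _ _]S1 linearD k10; congr (_ + k1 (s0 _)).
by apply: injective_projections => /=; rewrite linear0 ?subr0 ?oppr0.
Qed.

Lemma proj_cpx2_K_projective X : proj_cpx2 X -> K_projective X.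
Proof.
move=> projX; have [noeth _ _] := reg.
have [P [h [proj0 proj1 projP acP]]] := ex_resolution (proj_cpx2_fg noeth projX).
apply: (K_projective_cone (q := h)) => //.
by apply: acyclic_proj_contractible => //; apply: proj_module_prod; case: projX.
Qed.

End RegularLocal.

End Complexes.

(** * Equivalences onto localizations *)

#[local] Instance heq_equivalence (C : category) (X Y : C) :
  Equivalence (@heq C X Y).
Proof. by split; [exact: heq_refl | exact: heq_sym | exact: heq_trans]. Qed.

#[local] Instance hcomp_proper (C : category) (X Y Z : C) :
  Proper (@heq C Y Z ==> @heq C X Y ==> @heq C X Z) (@hcomp C X Y Z).
Proof. by move=> g g' gg' f f' ff'; exact: hcomp_heq. Qed.

#[local] Instance fmap_proper (C D : category) (F : functor C D) (X Y : C) :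
  Proper (@heq C X Y ==> @heq D (F X) (F Y)) (@fmap C D F X Y).
Proof. by move=> f g fg; exact: fmap_heq. Qed.

#[local] Hint Resolve heq_refl : core.

(* The objects [F P] see the elements of [S] as isomorphisms, so that the choice
   of an element [q X : F (G X) -> X] of [S] for each [X] is functorial on the
   localization. *)
Section LocalizationEquivalence.
Variables (C' C : category) (S : forall X Y : C, mor X Y -> Prop).
Variable F : functor C' C.
Hypothesis F_full : forall (P P' : C') (h : mor (F P) (F P')),
  exists f, fmap F f ~= h.
Hypothesis F_faithful : forall (P P' : C') (f g : mor P P'),
  fmap F f ~= fmap F g -> f ~= g.
Hypothesis S_lift : forall P (X Y : C) (s : mor X Y) (f : mor (F P) Y),
  S s -> exists g, s \c g ~= f.
Hypothesis S_inj : forall P (X Y : C) (s : mor X Y) (f g : mor (F P) X),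
  S s -> s \c f ~= s \c g -> f ~= g.
Hypothesis S_cover : forall X : C, exists P (q : mor (F P) X), S q.

Let Q := loc_functor S.
Let G X := sval (cid (S_cover X)).
Let q X : mor (F (G X)) X := sval (cid (svalP (cid (S_cover X)))).
Let Sq X : S (q X) := svalP (cid (svalP (cid (S_cover X)))).

Lemma ex_cover_lift P X (f : mor (F P) X) : exists g : mor P (G X), q X \c fmap F g ~= f.
Proof.
have [h hP] := S_lift f (Sq X); have [g gh] := F_full h.
by exists g; rewrite gh.
Qed.

Let lft P X (f : mor (F P) X) := sval (cid (ex_cover_lift f)).
Let lftP P X (f : mor (F P) X) : q X \c fmap F (lft f) ~= f :=
  svalP (cid (ex_cover_lift f)).

Lemma cover_lift_inj P X (f g : mor P (G X)) :
  q X \c fmap F f ~= q X \c fmap F g -> f ~= g.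
Proof. by move=> /(S_inj (Sq X)); exact: F_faithful. Qed.

(** The map between chosen covers lying over [u]; over the inverse of [s] it comes from lifting
    [q Y] through [s]. *)
Fixpoint cover_map X Y (u : loc_term S X Y) : mor (G X) (G Y) :=
  match u with
  | loc_mor X _ f => lft (f \c q X)
  | loc_inv _ Y s Ss => lft (sval (cid (S_lift (q Y) Ss)))
  | loc_comp _ _ _ v u => cover_map v \c cover_map u
  end.

Lemma cover_map_inv X Y (s : mor X Y) (Ss : S s) :
  s \c (q X \c fmap F (cover_map (loc_inv Ss))) ~= q Y.
Proof. by rewrite /= lftP; exact: svalP (cid (S_lift (q Y) Ss)). Qed.

Lemma cover_map_mor X Y (f : mor X Y) :
  q Y \c fmap F (cover_map (loc_mor S f)) ~= f \c q X.
Proof. exact: lftP. Qed.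

Lemma cover_map_comp X Y Z (v : loc_term S Y Z) (u : loc_term S X Y) :
  cover_map (loc_comp v u) = cover_map v \c cover_map u.
Proof. by []. Qed.

(** Each relation is checked after composition with the cover, where lifts are unique by
    [cover_lift_inj]. *)
Lemma cover_map_heq X Y (u v : loc_term S X Y) :
  loc_heq u v -> cover_map u ~= cover_map v.
Proof.
elim=> {X Y u v} //.
- by move=> X Y u v _ ->.
- by move=> X Y u v w _ -> _ ->.
- by move=> X Y Z v v' u u' _ vv' _ uu' /=; rewrite vv' uu'.
- by move=> *; exact: hcompA.
- move=> X Y u /=; rewrite -[X in _ ~= X]hcomp1; apply: hcomp_heq => //.
  by apply: cover_lift_inj; rewrite lftP h1comp fmap_id hcomp1.
- move=> X Y u /=; rewrite -[X in _ ~= X]h1comp; apply: hcomp_heq => //.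
  by apply: cover_lift_inj; rewrite lftP h1comp fmap_id hcomp1.
- move=> X Y f g fg; apply: cover_lift_inj.
  by rewrite !cover_map_mor fg.
- move=> X Y Z g f; apply: cover_lift_inj; rewrite cover_map_mor.
  rewrite cover_map_comp fmap_comp hcompA cover_map_mor.
  by rewrite -(hcompA g (q Y)) cover_map_mor hcompA.
- move=> X Y s Ss; apply: cover_lift_inj; apply: (S_inj Ss).
  rewrite cover_map_mor cover_map_comp fmap_comp !hcompA.
  by rewrite -(hcompA s) cover_map_inv cover_map_mor hcomp1.
- move=> X Y s Ss; apply: cover_lift_inj.
  rewrite cover_map_mor cover_map_comp fmap_comp !hcompA.
  by rewrite cover_map_mor -hcompA cover_map_inv h1comp.
Qed.

Lemma cover_map_natural X Y (u : loc_term S X Y) :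
  fmap Q (q Y \c fmap F (cover_map u)) ~= (u : @mor (loc_category S) X Y) \c fmap Q (q X).
Proof.
elim: u => {X Y} [X Y f|X Y s Ss|X Y Z v IHv u IHu].
- by rewrite cover_map_mor fmap_comp.
- rewrite -[X in X ~= _]h1comp.
  (* Inserting [s^-1 s = 1] on the left reduces this case to [cover_map_inv]. *)
  have <- : (loc_inv Ss : @mor (loc_category S) Y X) \c fmap Q s ~= idm (X : loc_category S).
    exact: loc_inv_l.
  by rewrite -hcompA -fmap_comp cover_map_inv.
rewrite cover_map_comp (fmap_comp F) hcompA fmap_comp IHv.
by rewrite -hcompA -fmap_comp IHu hcompA.
Qed.

Lemma cover_map_id X : cover_map (loc_mor S (idm X)) ~= idm (G X).
Proof.
by apply: cover_lift_inj; rewrite cover_map_mor fmap_id h1comp hcomp1.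
Qed.

Definition cover_functor : functor (loc_category S) C' :=
  @Functor (loc_category S) C' G cover_map cover_map_heq cover_map_id
    (fun X Y Z v u => heq_refl _).

Lemma is_iso_loc_cover X : is_iso (fmap Q (q X)).
Proof.
by exists (loc_inv (Sq X)); split; [exact: loc_inv_l | exact: loc_inv_r].
Qed.

Let eta P : mor (G (F P)) P := sval (cid (F_full (q (F P)))).
Let etaE P : fmap F (eta P) ~= q (F P) := svalP (cid (F_full (q (F P)))).

(** An element of [S] between objects of the form [F P] is invertible: [S_lift] gives a right
    inverse, and [S_inj] makes it two-sided. *)
Lemma is_iso_eta P : is_iso (eta P).
Proof.
have [g gP] := ex_cover_lift (idm (F P)); exists g.
split; last by apply: F_faithful; rewrite fmap_comp fmap_id etaE gP.
by apply: cover_lift_inj; rewrite fmap_comp fmap_id etaE hcompA gP h1comp hcomp1.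
Qed.

Theorem localization_equivalence : Defs.equivalence (functor_comp (loc_functor S) F).
Proof.
exists cover_functor; split; constructor.
  refine (@NatIso C' C' (functor_comp cover_functor (functor_comp Q F))
    (functor_id C') eta is_iso_eta _) => P P' f /=.
  by apply: F_faithful; rewrite !fmap_comp !etaE cover_map_mor.
refine (@NatIso (loc_category S) (loc_category S)
  (functor_comp (functor_comp Q F) cover_functor) (functor_id (loc_category S))
  (fun X => fmap Q (q X)) is_iso_loc_cover _) => X Y u.
rewrite -cover_map_natural fmap_comp; reflexivity.
Qed.

End LocalizationEquivalence.

Theorem theorem1p1 (A : comNzRingType) (m : {pred A})
    (reg : regular_local_ring m) :
  triangulated_equivalence (phi (regular_local_noetherian reg)).
Proof.
have noeth := regular_local_noetherian reg.
have projP (P : K2_proj A) : K_projective (sval P).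
  exact: (proj_cpx2_K_projective reg (svalP P)).
(* The functor underlying [phi] is this composite by definition. Its first factor is the inclusion
   of a full subcategory, so fullness and faithfulness are immediate. *)
apply: (@localization_equivalence (K2_proj A) (K2_fg A) (@acyclic_cone A)
  (full_incl (@proj_cpx2_shift A) (@fg_cpx2_shift A)
     (fun X => proj_cpx2_fg (regular_local_noetherian reg)))).
- by move=> P P' h; exists h; exact: heq_refl.
- by [].
- by move=> P X Y s f acs; exact: (K_projective_lift f (projP P) acs).
- move=> P X Y s f g acs [s0 [s1 [E0 E1]]].
  suff: null2 (sub_map2 f g) by [].
  apply: (@K_projective_inj _ _ _ (sval Y) s _ (projP P) acs); exists s0, s1.
  by split=> x; rewrite /= linearB; [exact: E0 | exact: E1].
- move=> [X fgX]; have [P [h [proj0 proj1 _ acP]]] := ex_resolution reg fgX.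
  by exists (exist _ P (conj proj0 proj1)), h.
Qed.
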